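(* For every pair of integers $m>n\ge 1$, we have \[ d_{\mathrm{GH}}(B^m,B^n)\;\ge\;\frac{1}{1+\alpha_n}\;=\; \begin{cases} \dfrac{\sqrt{n+2}}{\sqrt{n+2}+\sqrt n}, & n\text{ even},\\[2ex] \dfrac{\sqrt{(n+1)(n+3)}}{\sqrt{(n+1)(n+3)}+\sqrt{n^2+2n-1}}, & n\text{ odd}. \end{cases} \]
   Context: $B^n=\{x\in\mathbb{R}^n : x_1^2+\cdots+x_n^2\le 1\}$ is the closed unit ball, regarded as a metric space with the Euclidean metric. The Gromov--Hausdorff distance $d_{\mathrm{GH}}(X,Y)$ between metric spaces $X,Y$ is the infimum, over all metric spaces $Z$ and isometric embeddings $\phi\colon X\to Z$, $\psi\colon Y\to Z$, of the Hausdorff distance in $Z$ between $\phi(X)$ and $\psi(Y)$. Equivalently, $d_{\mathrm{GH}}(X,Y)=\frac12\inf_C \sup_{(x,y),(x',y')\in C}|d_X(x,x')-d_Y(y,y')|$, where $C$ ranges over all correspondences, i.e. relations $C\subseteq X\times Y$ whose projections to $X$ and to $Y$ are both surjective. For each $n\ge 1$, \[ \alpha_n=\sup\{d(X,Y) \mid X,Y\subseteq\mathbb{R}^n \text{ finite},\ \mathrm{diam}(X)\le 1,\ \mathrm{diam}(Y)\le 1,\ \mathrm{conv}(X)\cap\mathrm{conv}(Y)\neq\emptyset\}, \] where $d(X,Y)=\inf\{\|x-y\| : x\in X,\ y\in Y\}$, $\mathrm{diam}$ is the Euclidean diameter, and $\mathrm{conv}$ denotes the convex hull. *)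

(* Defs.v *)
(* MathComp / MathComp-Analysis; the reals are an arbitrary realType R. *)
From HB Require Import structures.
From mathcomp Require Import all_boot all_order all_algebra.
From mathcomp Require Import all_classical all_reals all_analysis.

Set Implicit Arguments.
Unset Strict Implicit.
Unset Printing Implicit Defensive.

Import Order.TTheory GRing.Theory Num.Theory.

Local Open Scope classical_set_scope.
Local Open Scope ring_scope.

(* The norm that MathComp-Analysis puts on 'rV[R]_n is the sup norm, whence
   this Euclidean one. *)
Definition enorm (R : realType) (n : nat) (x : 'rV[R]_n) : R :=
  Num.sqrt (\sum_i x ord0 i ^+ 2).

Section enorm_theory.
Context {R : realType} {n : nat}.
Implicit Types x y z : 'rV[R]_n.

Lemma enorm_ge0 x : 0 <= enorm x.
Proof. exact: sqrtr_ge0. Qed.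

Lemma sqr_enorm x : enorm x ^+ 2 = \sum_i x ord0 i ^+ 2.
Proof. by rewrite sqr_sqrtr// sumr_ge0// => i _; exact: sqr_ge0. Qed.

Lemma enorm0 : enorm (0 : 'rV[R]_n) = 0.
Proof. by rewrite /enorm big1 ?sqrtr0// => i _; rewrite mxE expr0n. Qed.

Lemma enorm0_eq0 x : enorm x = 0 -> x = 0.
Proof.
move=> x0; have /eqP := sqr_enorm x; rewrite x0 expr0n /= eq_sym.
rewrite psumr_eq0 => [/allP h|i _]; last exact: sqr_ge0.
apply/rowP => i; rewrite mxE; apply/eqP; rewrite -sqrf_eq0.
exact: h (mem_index_enum i).
Qed.

Lemma enormN x : enorm (- x) = enorm x.
Proof. by congr Num.sqrt; apply: eq_bigr => i _; rewrite mxE sqrrN. Qed.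

Lemma enorm_Cauchy_Schwarz x y :
  \sum_i x ord0 i * y ord0 i <= enorm x * enorm y.
Proof.
set p := \sum_i _; apply: le_trans (ler_norm p) _.
rewrite -(@ler_pXn2r _ 2)// ?nnegrE ?mulr_ge0 ?enorm_ge0//.
rewrite real_normK ?num_real// exprMn !sqr_enorm -subr_ge0.
rewrite -(@pmulr_rge0 _ 2)//.
have -> : 2 * ((\sum_i x ord0 i ^+ 2) * (\sum_i y ord0 i ^+ 2) - p ^+ 2) =
    \sum_i \sum_j (x ord0 i * y ord0 j - x ord0 j * y ord0 i) ^+ 2.
  under [RHS]eq_bigr do under eq_bigr do rewrite sqrrB !exprMn.
  under [RHS]eq_bigr do rewrite big_split sumrB /=.
  rewrite big_split sumrB /=.
  have -> : \sum_i \sum_j x ord0 j ^+ 2 * y ord0 i ^+ 2 =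
            \sum_i \sum_j x ord0 i ^+ 2 * y ord0 j ^+ 2 by rewrite exchange_big.
  have -> : \sum_i \sum_j x ord0 i * y ord0 j * (x ord0 j * y ord0 i) *+ 2 =
            p ^+ 2 *+ 2.
    rewrite expr2 /p mulr_suml -sumrMnl; apply: eq_bigr => i _.
    rewrite mulr_sumr -sumrMnl; apply: eq_bigr => j _.
    by congr (_ *+ 2); rewrite mulrACA [y _ j * _]mulrC mulrACA.
  have -> : \sum_i \sum_j x ord0 i ^+ 2 * y ord0 j ^+ 2 =
            (\sum_i x ord0 i ^+ 2) * (\sum_i y ord0 i ^+ 2).
    by rewrite mulr_suml; apply: eq_bigr => i _; rewrite mulr_sumr.
  by rewrite addrAC -mulr2n -mulrnBl mulr_natl.
by apply: sumr_ge0 => i _; apply: sumr_ge0 => j _; exact: sqr_ge0.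
Qed.

Lemma ler_enormD x y : enorm (x + y) <= enorm x + enorm y.
Proof.
rewrite -(@ler_pXn2r _ 2)// ?nnegrE ?addr_ge0 ?enorm_ge0//.
rewrite sqrrD !sqr_enorm.
under eq_bigr do rewrite mxE sqrrD.
rewrite !big_split /= lerD2r lerD2l -mulr2n lerMn2r /=.
exact: enorm_Cauchy_Schwarz.
Qed.

End enorm_theory.

Definition closed_unit_ball (R : realType) (n : nat) : Type :=
  {x : 'rV[R]_n | \sum_i x ord0 i ^+ 2 <= 1}.

Section closed_unit_ball_metric.
Context (R : realType) (n : nat).
Local Notation B := (closed_unit_ball R n).

HB.instance Definition _ := Choice.on B.

Let dist (x y : B) : R := enorm (val x - val y).

Let distxx x : dist x x = 0.
Proof. by rewrite /dist subrr enorm0. Qed.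

Let dist_positivity x y : dist x y = 0 -> x = y.
Proof. by move=> /enorm0_eq0/eqP; rewrite subr_eq0 => /eqP/val_inj. Qed.

Let dist_sym x y : dist x y = dist y x.
Proof. by rewrite /dist -enormN opprB. Qed.

Let dist_triangle y x z : dist x z <= dist x y + dist y z.
Proof. by rewrite /dist -(subrKA (val y)) ler_enormD. Qed.

HB.instance Definition _ :=
  @isMetric.Build R B dist distxx dist_positivity dist_sym dist_triangle.

End closed_unit_ball_metric.

Lemma closed_unit_ball_mdistE (R : realType) (n : nat)
    (x y : closed_unit_ball R n) : mdist x y = enorm (val x - val y).
Proof. by []. Qed.

(* Hausdorff and Gromov-Hausdorff distances are extended reals, so that they
   make sense for unbounded sets and spaces. *)
Definition hausdorff_dist (R : realType) (Z : metricType R) (A B : set Z)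
    : \bar R :=
  maxe (ereal_sup [set ereal_inf [set (mdist a b)%:E | b in B] | a in A])
       (ereal_sup [set ereal_inf [set (mdist a b)%:E | a in A] | b in B]).

Definition isometric_embedding (R : realType) (X Z : metricType R)
    (f : X -> Z) : Prop :=
  forall x x', mdist (f x) (f x') = mdist x x'.

Definition GH_dist (R : realType) (X Y : metricType R) : \bar R :=
  ereal_inf [set d | exists (Z : metricType R) (phi : X -> Z) (psi : Y -> Z),
    [/\ isometric_embedding phi, isometric_embedding psi &
        d = hausdorff_dist (range phi) (range psi)]].

Section alpha.
Context (R : realType) (n : nat).
Implicit Types X Y : set 'rV[R]_n.

Definition conv_hull X : set 'rV[R]_n :=
  [set x | forall C : set 'rV[R]_n, convex_set C -> X `<=` C -> C x].

Definition diam X : R := sup [set enorm (x - y) | x in X & y in X].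

Definition set_dist X Y : R := inf [set enorm (x - y) | x in X & y in Y].

(* X and Y are nonempty since their hulls meet, so the real-valued sup in diam
   and inf in set_dist are genuine; so is the outer sup, as these conditions
   force set_dist X Y <= 2. *)
Definition alpha : R :=
  sup [set r | exists X Y,
    [/\ finite_set X /\ finite_set Y, diam X <= 1, diam Y <= 1,
        conv_hull X `&` conv_hull Y !=set0 & r = set_dist X Y]].

End alpha.

(* Main.v *)
Require Import Defs.
From HB Require Import structures.
From mathcomp Require Import all_boot all_order all_algebra.
From mathcomp Require Import all_classical all_reals all_analysis.
From mathcomp Require Import lra ring zify.

Import Order.TTheory GRing.Theory Num.Theory.
Import numFieldNormedType.Exports.

Set Implicit Arguments.
Unset Strict Implicit.
Unset Printing Implicit Defensive.

Local Open Scope ring_scope.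

(**
The lower bound on the Gromov-Hausdorff distance is a Borsuk-Ulam argument for
discontinuous maps. If the Hausdorff distance between copies of the balls
B^m and B^n is below r, choosing near points gives f : B^m -> B^n that changes
distances by at most 2r. As m > n, the ball B^m contains the sphere S^n.
Take a fine antipodally symmetric triangulation of S^n and extend f from its
vertices linearly to simplices. The Borsuk-Ulam theorem gives a point with the
same image as its antipode, that is, a small simplex s such that the hulls of
f(s) and f(-s) meet. Both vertex images have diameter at most 2r + e, so
by definition of alpha some x, y in s satisfy
|f(x) - f(-y)| <= alpha (2r + e); but x and -y are nearly antipodal,
so |f(x) - f(-y)| >= 2 - e - 2r. Letting e tend to 0 gives 1 <= r (1 + alpha).
This is [ball_distortion_ge]; it uses an approximate version
[approximate_borsuk_ulam], in which the hulls nearly meet, and then translates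
one of the two sets.

The Borsuk-Ulam theorem is obtained from Ky Fan's combinatorial lemma.
Chains and simplices appear only through cochains mod 2 on ordered tuples of
points: barycentric subdivision becomes an operator on cochains that commutes
with the coboundary ([cobd_subdiv]), the octahedral sphere becomes a linear
functional [oct] on cochains, and Fan's lemma becomes the identity
[cobd_alternates], fed into the induction over spheres of increasing dimension
[oct_odd]. Subdividing first in the source, then again after passing to the
pairs (f x, f (- x)), replaces the piecewise linear extension of f and its
fine triangulation.

The value of alpha comes from a variance identity. If a point of R^n is a convex
combination of X and of Y, Caratheodory's argument leaves p points of X and q
points of Y with p + q <= n + 2 ([weights_caratheodory]). Averaging
|x - y|^2 over the two sets of weights gives half the sum of the averages of
|x - x'|^2 and |y - y'|^2, hence at most 1 - (1/p + 1/q) / 2, because the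
diagonal terms vanish ([weights_close_rows]). With p + q = n + 2, this is
largest when p and q differ by at most 1, and two regular simplices with a
common centre, in orthogonal subspaces, attain it ([orthogonal_simplices]).
*)

(** * Convex sets and the Euclidean norm *)

Lemma convex_setP (R : realFieldType) (V : lmodType R) (C : set V) :
  convex_set C <->
  (forall x y (p : R), 0 <= p -> p <= 1 -> C x -> C y ->
    C (p *: x + (1 - p) *: y)).
Proof.
split=> [cC x y p p0 p1 Cx Cy|cC x y p /set_mem Cx /set_mem Cy].
  by rewrite -inE; apply: (cC x y (Itv01 p0 p1)); rewrite inE.
by rewrite inE; apply: cC.
Qed.

Section Euclidean.
Context {R : realType} {n : nat}.
Implicit Types x y : 'rV[R]_n.

Lemma enormZ (a : R) x : enorm (a *: x) = `|a| * enorm x.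
Proof.
rewrite /enorm -sqrtr_sqr -sqrtrM ?sqr_ge0// mulr_sumr; congr Num.sqrt.
by apply: eq_bigr => i _; rewrite mxE exprMn.
Qed.

Lemma coord_le_enorm x i : `|x ord0 i| <= enorm x.
Proof.
rewrite -sqrtr_sqr ler_wsqrtr// (bigD1 i)//= lerDl sumr_ge0// => j _.
exact: sqr_ge0.
Qed.

Lemma enorm_le_coord x k : (forall i, `|x ord0 i| <= `|x ord0 k|) ->
  enorm x <= n%:R * `|x ord0 k|.
Proof.
move=> xk; rewrite -(@ler_pXn2r _ 2)// ?nnegrE ?mulr_ge0 ?enorm_ge0//.
rewrite sqr_enorm (@le_trans _ _ (\sum_(i < n) `|x ord0 k| ^+ 2))//.
  apply: ler_sum => i _.
  by rewrite -[leLHS]real_normK ?num_real// lerXn2r ?nnegrE.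
rewrite sumr_const card_ord exprMn -[leLHS]mulr_natl ler_wpM2r ?sqr_ge0//.
have n0 : (0 < n)%N by case: n k {x xk} => // -[].
by rewrite -natrX ler_nat -mulnn leq_pmull.
Qed.

Lemma ler_dist_enorm x y : `|enorm x - enorm y| <= enorm (x - y).
Proof.
rewrite ler_norml; apply/andP; split.
  have := ler_enormD (y - x) x; rewrite subrK -(enormN (y - x)) opprB; lra.
by have := ler_enormD (x - y) y; rewrite subrK; lra.
Qed.

End Euclidean.

Lemma sqr_enorm_row_mx (R : realType) (p q : nat)
    (x : 'rV[R]_p) (y : 'rV[R]_q) :
  enorm (row_mx x y) ^+ 2 = enorm x ^+ 2 + enorm y ^+ 2.
Proof.
rewrite !sqr_enorm big_split_ord /=; congr (_ + _); apply: eq_bigr => i _.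
  by rewrite row_mxEl.
by rewrite row_mxEr.
Qed.

Lemma enorm_le_sqr (R : realType) (p : nat) (x : 'rV[R]_p) (D : R) :
  0 <= D -> (enorm x <= D) = (enorm x ^+ 2 <= D ^+ 2).
Proof. by move=> D0; rewrite ler_pXn2r ?nnegrE ?enorm_ge0. Qed.

(** * Cochains mod 2 on tuples *)

Section Cochains.
Context {T : eqType}.
Implicit Types (s r t : seq T) (phi psi : seq T -> bool).

Fixpoint faces s : seq (seq T) :=
  if s is x :: s' then s' :: [seq x :: r | r <- faces s'] else [::].

(** The coboundary mod 2: [cobd phi s] is the sum of [phi] over [faces s], with
    [addb] as addition of the two-element field. Working mod 2 with ordered
    tuples, possibly with repetitions, dispenses with orientations and with
    degenerate simplices. The recursion reads the tuple as a cone over its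
    tail, which is how every identity below is proved. *)
Fixpoint cobd phi s {struct s} : bool :=
  if s is x :: s' then phi s' (+) cobd (fun t => phi (x :: t)) s' else false.

Lemma mem_faces s r : r \in faces s ->
  size s = (size r).+1 /\ {subset r <= s}.
Proof.
elim: s r => [//|x s IH] r /=; rewrite inE => /predU1P[->|].
  by split=> // y ys; rewrite inE ys orbT.
case/mapP => r' /IH[-> sub] ->; split=> // y; rewrite !inE.
by case: (y == x) => //= /sub.
Qed.

Lemma eq_cobd phi psi s : (forall r, r \in faces s -> phi r = psi r) ->
  cobd phi s = cobd psi s.
Proof.
elim: s phi psi => [//|x s IH] phi psi e /=; congr (_ (+) _).
  by apply: e; rewrite inE eqxx.
by apply: IH => r rs; apply: e; rewrite inE map_f ?orbT.
Qed.

Lemma cobd0 s : cobd (fun=> false) s = false.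
Proof. by elim: s => //= x s ->. Qed.

Lemma cobdD phi psi s :
  cobd (fun t => phi t (+) psi t) s = cobd phi s (+) cobd psi s.
Proof. by elim: s phi psi => //= x s IH phi psi; rewrite IH addbACA. Qed.

(** For the cone [x :: s], the face [s] is met once directly and once as the
    base of the cones over the faces of [s]: the two contributions cancel. *)
Lemma cobd_cobd phi s : cobd (cobd phi) s = false.
Proof. by elim: s phi => //= x s IH phi; rewrite cobdD IH addbF addbb. Qed.

Lemma cobd_rem phi s :
    (forall r t, perm_eq r t -> phi r = phi t) ->
  cobd phi s = \big[addb/false]_(x <- s) phi (rem x s).
Proof.
elim: s phi => [|y s IH] phi phiP /=; first by rewrite big_nil.
rewrite big_cons eqxx IH; last first.
  by move=> r t rt; apply: phiP; rewrite perm_cons.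
congr (_ (+) _); apply: eq_big_seq => x xs; apply: phiP.
by case: eqP => [->|//]; rewrite perm_sym perm_to_rem.
Qed.

(** A symmetric cochain has a symmetric coboundary, since the faces of a tuple
    are, up to order, the tuple with one of its entries removed. *)
Lemma cobd_perm phi s t :
    (forall r t, perm_eq r t -> phi r = phi t) ->
  perm_eq s t -> cobd phi s = cobd phi t.
Proof.
move=> phiP st; rewrite !cobd_rem// (perm_big _ st).
apply: eq_big_seq => x xt; apply: phiP.
have xs : x \in s by rewrite (perm_mem st).
rewrite -(perm_cons x) -(permPl (perm_to_rem xs)).
by rewrite (perm_trans st) ?perm_to_rem.
Qed.

End Cochains.

Lemma cobd_map (T U : eqType) (g : T -> U) phi s :
  cobd phi (map g s) = cobd (phi \o map g) s.
Proof. by elim: s phi => //= x s IH phi; rewrite IH. Qed.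

(** * Fan's alternating labels *)

Section Fan.
Implicit Types (l : seq nat) (b : bool).

(** A label [x : nat] stands for a vertex of a cross-polytope: its axis is
    [x./2] and it lies on the positive side when [x] is odd. Opposite vertices
    are thus [2 i] and [2 i + 1], and [{in l &, injective half}] says that no
    two entries of [l] are opposite. Here the entries are on increasing axes
    and their sides alternate, starting with [b]. *)
Fixpoint sorted_alternates b l : bool :=
  if l is x :: l' then
    [&& odd x == b, all (fun y => x./2 < y./2)%N l' &
      sorted_alternates (~~ b) l']
  else true.

Definition alternates b l := sorted_alternates b (sort leq l).

Lemma perm_alternates b l l' :
  perm_eq l l' -> alternates b l = alternates b l'.
Proof.
move=> p; congr sorted_alternates; apply/perm_sortP => //.
- exact: leq_total.
- exact: leq_trans.
- exact: anti_leq.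
Qed.

(** Fan's count of alternating facets. A nonempty tuple that alternates from
    [b] has exactly one facet of the same kind, obtained by deleting its last
    entry; one that alternates from [~~ b] also has exactly one, obtained by
    deleting its first entry. In any other tuple, such a facet comes from
    deleting one of two consecutive entries on the same side, so these facets
    come in pairs. The absence of opposite labels is used when two entries
    share an axis: they are then equal. *)
Lemma cobd_sorted_alternates b l :
    sorted leq l -> {in l &, injective half} ->
  cobd (sorted_alternates b) l =
    sorted_alternates b l (+) sorted_alternates (~~ b) l.
Proof.
elim: l b => [//|x l IH] b sl inj; rewrite /= negbK.
have sl' : sorted leq l by apply: path_sorted sl.
have inj' : {in l &, injective half}.
  by move=> y z yl zl; apply: inj; rewrite inE ?yl ?zl orbT.
have le_x : all (leq x) l by rewrite order_path_min//; exact: leq_trans.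
have [lt_x|] := boolP (all (fun y => x./2 < y./2)%N l).
  have [ob|ob] := eqVneq (odd x) b.
    rewrite (@eq_cobd _ _ (sorted_alternates (~~ b))); last first.
      move=> r /mem_faces[_ rl]; rewrite (_ : all _ r) //.
      by apply/allP => y /rl; exact: (allP lt_x).
    rewrite IH// negbK ob /= (_ : (b == ~~ b) = false); last by case: b {ob}.
    by case: sorted_alternates; case: sorted_alternates.
  rewrite cobd0 (_ : (odd x == ~~ b) = true) ?addbF//.
  by move: ob; case: odd; case: b.
rewrite -has_predC => /hasP[y yl /=]; rewrite -leqNgt => yx.
have xy : x = y.
  apply: inj; rewrite ?inE ?eqxx ?yl ?orbT//.
  by apply/eqP; rewrite eqn_leq yx half_leq// (allP le_x).
case: l {IH inj inj' sl'} sl le_x yl => // z l sl le_x yl.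
have {sl le_x yl} <- : x = z.
  apply/eqP; rewrite eqn_leq; move: sl => /= /andP[-> zl] /=.
  move: yl; rewrite -xy inE => /predU1P[->|xl] //.
  by have /allP/(_ _ xl) := order_path_min leq_trans zl.
rewrite /= ltnn /= !andbF addbA addbF.
rewrite (@eq_cobd _ _ (fun=> false)) ?cobd0 ?addbF ?addbb//.
Qed.

(** Sorting reduces to the previous count, as faces of a sorted tuple are
    sorted. *)
Lemma cobd_alternates b l : {in l &, injective half} ->
  cobd (alternates b) l = alternates b l (+) alternates (~~ b) l.
Proof.
move=> inj; rewrite (@cobd_perm _ _ _ (sort leq l)); last 2 first.
- exact: perm_alternates.
- by rewrite perm_sym perm_sort.
rewrite (@eq_cobd _ _ (sorted_alternates b)).
  rewrite cobd_sorted_alternates ?sort_sorted// => x y.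
  by rewrite !mem_sort; exact: inj.
have : sorted leq (sort leq l) := sort_sorted leq_total l.
move: (sort leq l) => {inj}{}l sl r rl; congr sorted_alternates.
apply/sorted_sort; first exact: leq_trans.
elim: l r sl rl => //= x l IH r sl; rewrite inE => /predU1P[->|].
  exact: path_sorted sl.
case/mapP => t tl ->/=; rewrite path_min_sorted.
  by apply: IH; rewrite // (path_sorted sl).
apply/allP => y; have [_ sub] := mem_faces tl; move/sub.
exact/allP/(order_path_min leq_trans sl).
Qed.

Lemma alternates_size n b l :
  {in l, forall x, x./2 < n}%N -> alternates b l -> (size l <= n)%N.
Proof.
rewrite -(size_sort leq) => lt_n al.
have {lt_n} : {in sort leq l, forall x, x./2 < n}%N.
  by move=> x; rewrite mem_sort; exact: lt_n.
move: al; rewrite /alternates; move: (sort leq l) => {}l al lt_n.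
rewrite -(size_map half) -(size_iota 0 n); apply: uniq_leq_size.
  elim: l b al {lt_n} => //= x l IH b /and3P[_ lt_x /IH ->]; rewrite andbT.
  by apply/mapP => -[y yl e]; have := allP lt_x _ yl; rewrite e ltnn.
by move=> _ /mapP[x /lt_n xn ->]; rewrite mem_iota.
Qed.

End Fan.

Definition opposite_label x : nat := (~~ odd x + x./2.*2)%N.

Lemma half_opposite_label x : (opposite_label x)./2 = x./2.
Proof. by rewrite /opposite_label half_bit_double. Qed.

Lemma odd_opposite_label x : odd (opposite_label x) = ~~ odd x.
Proof. by rewrite /opposite_label oddD odd_double addbF oddb. Qed.

(** Without opposite labels, going to the opposite labels does not change the
    order of the entries, because their axes are distinct or they are equal. *)
Lemma alternates_opposite b l : {in l &, injective half} ->
  alternates b (map opposite_label l) = alternates (~~ b) l.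
Proof.
move=> inj.
have -> : alternates b (map opposite_label l) =
    sorted_alternates b (map opposite_label (sort leq l)).
  congr sorted_alternates; apply: (sorted_eq leq_trans anti_leq).
  - exact: sort_sorted leq_total _.
  - have {}inj : {in sort leq l &, injective half}.
      by move=> x y; rewrite !mem_sort; exact: inj.
    rewrite sorted_map; have srt := sort_sorted leq_total l.
    apply: (sub_in_sorted _ (allss (sort leq l)) srt) => x y xl yl xy /=.
    have [/inj->//|] := eqVneq x./2 y./2.
    by have := half_leq xy; rewrite /opposite_label; lia.
  - by rewrite perm_sort perm_map// perm_sym perm_sort.
rewrite /alternates; elim: (sort leq l) b => //= x t IH b.
rewrite IH odd_opposite_label; congr [&& _, _ & _].
  by case: odd; case: b.
by rewrite all_map; apply: eq_all => y /=; rewrite !half_opposite_label.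
Qed.

(** * Barycentric subdivision *)

Section Subdivision.
Context {R : realFieldType} {V : lmodType R}.
Implicit Types (s r t : seq V) (phi psi : seq V -> bool).

Definition barycenter s : V := (size s)%:R^-1 *: \sum_(x <- s) x.

(** The transpose of barycentric subdivision: [subdivk (size s) phi s] is the
    sum of [phi] over the simplices of the subdivision of [s], which are the
    cones with apex [barycenter s] over those of the subdivided faces. The
    counter [k], always the size of [s], makes the recursion structural. *)
Fixpoint subdivk k phi s : bool :=
  if k is k'.+1 then cobd (subdivk k' (fun t => phi (barycenter s :: t))) s
  else phi [::].

Definition subdiv phi s := subdivk (size s) phi s.

Lemma subdivkD k phi psi s :
  subdivk k (fun t => phi t (+) psi t) s = subdivk k phi s (+) subdivk k psi s.
Proof.
elim: k phi psi s => //= k IH phi psi s; rewrite -cobdD.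
by apply: eq_cobd => r _; rewrite IH.
Qed.

(** Subdivision is a chain map. The faces of a cone [b :: t] are [t] and the
    cones over the faces of [t]; by induction, the contribution of the latter
    is a double coboundary, which vanishes. *)
Lemma cobd_subdiv phi s : cobd (subdiv phi) s = subdiv (cobd phi) s.
Proof.
have H k psi r : size r = k.+1 ->
    cobd (subdiv psi) r = cobd (subdivk k psi) r.
  move=> rk; apply: eq_cobd => t /mem_faces[]; rewrite rk => -[kt] _.
  by rewrite /subdiv -kt.
rewrite /subdiv; move: (erefl (size s)); move: {-1}(size s) => k.
elim: k phi s => [phi [|//] //|k IH] phi s sk.
rewrite (H k)//= -[LHS]addbF.
rewrite -(cobd_cobd (subdiv (fun t => phi (barycenter s :: t))) s) -cobdD.
apply: eq_cobd => r /mem_faces[]; rewrite sk => -[rk] _.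
rewrite subdivkD; congr (_ (+) _).
by rewrite IH // rk.
Qed.

(** The tuples [t] at which [subdiv phi s] evaluates [phi]: hypotheses about
    the shape of the subdivision are transferred to cochains through
    [eq_subdiv]. *)
Inductive subdivides : seq V -> seq V -> Prop :=
| Subdivides0 : subdivides [::] [::]
| SubdividesS s r t : r \in faces s -> subdivides r t ->
    subdivides s (barycenter s :: t).

Lemma eq_subdiv phi psi s : (forall t, subdivides s t -> phi t = psi t) ->
  subdiv phi s = subdiv psi s.
Proof.
rewrite /subdiv; move: (erefl (size s)); move: {-1}(size s) => k.
elim: k phi psi s => [|k IH] phi psi s sk e.
  by case: s sk e => // _; apply; constructor.
apply: eq_cobd => r rs; have [] := mem_faces rs; rewrite sk => -[rk] _.
by apply: IH => // t rt; apply: e; apply: SubdividesS rt.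
Qed.

Lemma subdivides_size s t : subdivides s t -> size t = size s.
Proof. by elim=> //= {}s r {}t /mem_faces[-> _] _ ->. Qed.

Definition iter_subdiv k phi := iter k subdiv phi.

Fixpoint iter_subdivides k s t : Prop :=
  if k is k'.+1 then exists2 r, subdivides s r & iter_subdivides k' r t
  else t = s.

Lemma eq_iter_subdiv k phi psi s :
    (forall t, iter_subdivides k s t -> phi t = psi t) ->
  iter_subdiv k phi s = iter_subdiv k psi s.
Proof.
elim: k s => [|k IH] s e /=; first exact: e.
by apply: eq_subdiv => r sr; apply: IH => t rt; apply: e; exists r.
Qed.

Lemma iter_subdivides_size k s t : iter_subdivides k s t -> size t = size s.
Proof.
elim: k s => [s ->//|k IH s /= [r /subdivides_size <-]]; exact: IH.
Qed.

Lemma cobd_iter_subdiv k phi s :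
  cobd (iter_subdiv k phi) s = iter_subdiv k (cobd phi) s.
Proof.
elim: k s => //= k IH s; rewrite cobd_subdiv.
by apply: eq_subdiv => r _; exact: IH.
Qed.

Lemma subdivD phi psi s :
  subdiv (fun t => phi t (+) psi t) s = subdiv phi s (+) subdiv psi s.
Proof. exact: subdivkD. Qed.

Lemma iter_subdivD k phi psi s :
  iter_subdiv k (fun t => phi t (+) psi t) s =
    iter_subdiv k phi s (+) iter_subdiv k psi s.
Proof.
elim: k s => //= k IH s; rewrite -subdivD.
by apply: eq_subdiv => r _; exact: IH.
Qed.

Lemma iter_subdiv0 k s : iter_subdiv k (fun=> false) s = false.
Proof. by rewrite -(addbb false) iter_subdivD addbb. Qed.

Lemma iter_subdiv_nil k phi : iter_subdiv k phi [::] = phi [::].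
Proof. by elim: k. Qed.

Lemma convex_barycenter (C : set V) s : convex_set C -> s != [::] ->
  {in s, forall x, C x} -> C (barycenter s).
Proof.
move=> /convex_setP cC; case: s => // x s _; elim: s x => [|y s IH] x Cs.
  by rewrite /barycenter big_seq1 /= invr1 scale1r; apply: Cs; rewrite inE.
have -> : barycenter [:: x, y & s] = ((size s).+2%:R^-1 : R) *: x +
    (1 - (size s).+2%:R^-1) *: barycenter (y :: s).
  rewrite /barycenter big_cons scalerDr /= scalerA; congr (_ + _ *: _).
  have -> : (size s).+2%:R = (size s).+1%:R + 1 :> R by rewrite natr1.
  have : (size s).+1%:R + 1 != 0 :> R by rewrite natr1 pnatr_eq0.
  have : (size s).+1%:R != 0 :> R by rewrite pnatr_eq0.
  by move=> ? ?; field; apply/andP.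
apply: cC; rewrite ?invr_ge0 ?ler0n ?invf_le1 ?ltr0n ?ler1n//.
  by apply: Cs; rewrite inE eqxx.
by apply: IH => z zs; apply: Cs; rewrite inE zs orbT.
Qed.

Lemma subdivides_convex (C : set V) s t : convex_set C -> subdivides s t ->
  {in s, forall x, C x} -> {in t, forall x, C x}.
Proof.
move=> cC; elim=> [//|{}s r {}t rs _ IH Cs]; have [sr sub] := mem_faces rs.
move=> x; rewrite inE => /predU1P[->|]; last by apply: IH => y /sub/Cs.
by apply: convex_barycenter => //; rewrite -size_eq0 sr.
Qed.

Lemma iter_subdivides_convex (C : set V) k s t : convex_set C ->
  iter_subdivides k s t -> {in s, forall x, C x} -> {in t, forall x, C x}.
Proof.
move=> cC; elim: k s => [s ->//|k IH s /= [r sr rt] Cs].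
by apply: IH rt _; apply: subdivides_convex Cs.
Qed.

Section Mesh.
Variable N : V -> R.
Hypothesis ND : forall x y, N (x + y) <= N x + N y.
Hypothesis NZ : forall a x, N (a *: x) = `|a| * N x.

Let N0 : N 0 = 0.
Proof. by rewrite -(scale0r 0) NZ normr0 mul0r. Qed.

Let NN x : N (- x) = N x.
Proof. by rewrite -scaleN1r NZ normrN1 mul1r. Qed.

Let N_ge0 x : 0 <= N x.
Proof. by have := ND x (- x); rewrite subrr N0 NN; lra. Qed.

Lemma seminorm_sum s : N (\sum_(x <- s) x) <= \sum_(x <- s) N x.
Proof.
elim: s => [|x s IH]; first by rewrite !big_nil N0.
by rewrite !big_cons (le_trans (ND _ _))// lerD2l.
Qed.

Lemma convex_seminorm_ball c D : convex_set [set x | N (c - x) <= D]%classic.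
Proof.
apply/convex_setP => x y p p0 p1 /= xD yD.
have -> : c - (p *: x + (1 - p) *: y) = p *: (c - x) + (1 - p) *: (c - y).
  by rewrite !scalerBr addrACA -scalerDl [p + _]addrC subrK opprD scale1r.
rewrite (le_trans (ND _ _))// !NZ !ger0_norm ?subr_ge0//.
have : p * N (c - x) <= p * D by rewrite ler_wpM2l.
have : (1 - p) * N (c - y) <= (1 - p) * D by rewrite ler_wpM2l// subr_ge0.
by lra.
Qed.

Definition mesh_le D s := {in s &, forall x y, N (x - y) <= D}.

(** The distance from [x] to the barycentre is at most the average of its
    distances to the points of [s], one of which is [x] itself. *)
Lemma barycenter_mesh D s x : mesh_le D s -> x \in s ->
  N (barycenter s - x) <= (size s).-1%:R / (size s)%:R * D.
Proof.
move=> sD xs; have s0 : (0 < size s)%N by case: s xs {sD}.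
have -> : barycenter s - x = (size s)%:R^-1 *: \sum_(y <- s) (y - x).
  rewrite sumrB scalerBr -/(barycenter s) big_const_seq count_predT.
  rewrite iter_addr_0 -[x *+ _]scaler_nat scalerA mulVf ?scale1r//.
  by rewrite pnatr_eq0 -lt0n.
rewrite NZ ger0_norm ?invr_ge0// [_ / _]mulrC -mulrA ler_wpM2l ?invr_ge0//.
rewrite -(big_map (fun y => y - x) xpredT id) (le_trans (seminorm_sum _))//.
rewrite big_map (perm_big _ (perm_to_rem xs)) big_cons /= subrr N0 add0r.
rewrite -(size_rem xs) mulr_natl -iter_addr_0 -count_predT -big_const_seq.
by rewrite big_seq [leRHS]big_seq ler_sum// => y /mem_rem ys; exact: sD.
Qed.

(** Two vertices of a simplex [t] of the subdivision are barycentres of nested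
    faces of [s]. The larger face lies, by convexity, in the ball about its
    barycentre given by [barycenter_mesh], and the smaller barycentre is in
    that face. *)
Lemma subdivides_mesh k D s t : (size s <= k.+1)%N -> subdivides s t ->
  mesh_le D s -> mesh_le (k%:R / k.+1%:R * D) t.
Proof.
move=> + st; elim: st => [//|{}s r {}t rs rt IH sk sD].
have [sr sub] := mem_faces rs.
have s0 : (0 < size s)%N by rewrite sr.
have D0 : 0 <= D.
  case: s s0 sD {IH sk rs sr sub} => // x s _ /(_ x x); rewrite subrr N0.
  by apply; rewrite inE eqxx.
have bD x : x \in t -> N (barycenter s - x) <= k%:R / k.+1%:R * D.
  move: x; have cB := @convex_seminorm_ball (barycenter s).
  have := subdivides_convex (cB _) rt; apply=> x /sub xs /=.
  rewrite (le_trans (barycenter_mesh sD xs))// ler_wpM2r//.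
  rewrite ler_pdivrMr ?ltr0n// mulrAC ler_pdivlMr ?ltr0n//.
  by rewrite -!natrM ler_nat; lia.
have {}IH : mesh_le (k%:R / k.+1%:R * D) t.
  apply: IH => [|x y /sub xs /sub ys]; last exact: sD.
  by move: sk; rewrite sr => /ltnW.
move=> x y; rewrite !inE => /predU1P[->|xt] /predU1P[->|yt]; last exact: IH.
- by rewrite subrr N0 !mulr_ge0.
- exact: bD.
- by rewrite -NN opprB bD.
Qed.

Lemma iter_subdivides_mesh k n D s t : (size s <= k.+1)%N ->
    iter_subdivides n s t ->
  mesh_le D s -> mesh_le ((k%:R / k.+1%:R) ^+ n * D) t.
Proof.
move=> + + sD; elim: n s D sD => [s D sD _ ->|n IH s D sD sk /= [r sr rt]].
  by rewrite expr0 mul1r.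
rewrite exprSr -mulrA; apply: IH rt; last by rewrite (subdivides_size sr).
exact: subdivides_mesh sr sD.
Qed.

End Mesh.
End Subdivision.

Lemma subdiv_map (R : realFieldType) (V W : lmodType R) (g : {linear V -> W})
  phi s : subdiv phi (map g s) = subdiv (phi \o map g) s.
Proof.
rewrite /subdiv size_map; move: (size s) => k.
elim: k phi s => //= k IH phi s; rewrite cobd_map; apply: eq_cobd => r _ /=.
rewrite IH; congr (subdivk _ _ _); apply/funext => t /=.
suff -> : barycenter (map g s) = g (barycenter s) by [].
by rewrite /barycenter big_map size_map -linear_sum linearZ.
Qed.

Lemma iter_subdiv_map (R : realFieldType) (V W : lmodType R)
  (g : {linear V -> W}) n phi s :
  iter_subdiv n phi (map g s) = iter_subdiv n (phi \o map g) s.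
Proof.
elim: n s => //= n IH s; rewrite subdiv_map.
by apply: eq_subdiv => t _; exact: IH.
Qed.

(** * Labels from the largest coordinate *)

Section Labels.
Context {R : realType} {n : nat}.
Implicit Types y : 'rV[R]_n.+1.

Definition peak y : 'I_n.+1 := [arg max_(i > ord0) `|y ord0 i|]%O.

Lemma peakP y i : `|y ord0 i| <= `|y ord0 (peak y)|.
Proof. by rewrite /peak; case: arg_maxP => //= j _; apply. Qed.

Lemma peakN y : peak (- y) = peak y.
Proof.
rewrite /peak; congr Order.arg_max.
by apply/funext => i; rewrite mxE normrN.
Qed.

Definition label y : nat := ((0 < y ord0 (peak y))%R + (peak y).*2)%N.

Lemma half_label y : (label y)./2 = peak y.
Proof. exact: half_bit_double. Qed.

Lemma odd_label y : odd (label y) = (0 < y ord0 (peak y)).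
Proof. by rewrite /label oddD odd_double addbF oddb. Qed.

Lemma labelN y : y != 0 -> label (- y) = opposite_label (label y).
Proof.
move=> y0; rewrite /opposite_label half_label odd_label /label peakN mxE.
rewrite oppr_gt0; congr (_ + _)%N; congr nat_of_bool; rewrite -leNgt.
rewrite le_eqVlt; case: eqP => // yp0.
case/eqP: y0; apply/rowP => i; rewrite mxE; apply/eqP.
by rewrite -normr_le0 (le_trans (peakP y i))// yp0 normr0.
Qed.

(** Opposite labels on a common axis [i] would mean that [y] and [z] have
    coordinates of opposite signs there, so that [y - z] has norm at least [`|y
    i|], which is at least [enorm y / n.+1]. *)
Lemma label_inj y z : enorm (y - z) * n.+1%:R < enorm y ->
  (label y)./2 = (label z)./2 -> label y = label z.
Proof.
rewrite !half_label => yz /val_inj pyz; rewrite /label pyz; congr (_ + _)%N.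
congr nat_of_bool.
have := enorm_le_coord (peakP y); rewrite pyz; move: {pyz}(peak z) => i yi.
have {}yz : `|y ord0 i - z ord0 i| < `|y ord0 i|.
  rewrite -(@ltr_pM2l _ n.+1%:R) ?ltr0n// (lt_le_trans _ yi)//.
  rewrite (le_lt_trans _ yz)// mulrC ler_wpM2r//.
  by have := coord_le_enorm (y - z) i; rewrite !mxE.
move: yz; case: (ltrP 0 (y ord0 i)) => y0; rewrite ltr_norml.
  by rewrite gtr0_norm// => /andP[_ ?]; case: ltrP => //; lra.
by rewrite ler0_norm// => /andP[? _]; case: ltrP => //; lra.
Qed.

End Labels.

(** * The octahedral sphere *)

Section Octahedral.
Context {V : zmodType} {I : eqType} (e : I -> V).
Implicit Types (i : I) (ix : seq I) (phi : seq V -> bool).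

(** The simplices of the boundary of the cross-polytope spanned by the points
    [e i] and [- e i], for [i] in [ix]: one sign is chosen on each axis. *)
Fixpoint oct_simplices ix : seq (seq V) :=
  if ix is i :: ix' then
    [seq e i :: s | s <- oct_simplices ix'] ++
    [seq - e i :: s | s <- oct_simplices ix']
  else [:: [::]].

Fixpoint oct ix phi : bool :=
  if ix is i :: ix' then
    oct ix' (fun s => phi (e i :: s)) (+) oct ix' (fun s => phi (- e i :: s))
  else phi [::].

Lemma eq_oct ix phi psi : {in oct_simplices ix, phi =1 psi} ->
  oct ix phi = oct ix psi.
Proof.
elim: ix phi psi => [|i ix IH] phi psi eq /=; first by apply: eq; rewrite inE.
by congr (_ (+) _); apply: IH => s ss; apply: eq;
  rewrite mem_cat map_f ?orbT.
Qed.

Lemma octD ix phi psi :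
  oct ix (fun s => phi s (+) psi s) = oct ix phi (+) oct ix psi.
Proof. by elim: ix phi psi => //= i ix IH phi psi; rewrite !IH addbACA. Qed.

(** The sphere has no boundary: a face missing the axis [i] belongs to two
    simplices, one for each sign on that axis. *)
Lemma oct_cobd ix phi : oct ix (cobd phi) = false.
Proof.
by elim: ix phi => //= i ix IH phi; rewrite !octD !IH !addbF addbb.
Qed.

Lemma oct_opp ix phi : oct ix (phi \o map -%R) = oct ix phi.
Proof.
elim: ix phi => //= i ix IH phi.
rewrite -[in RHS]IH -[X in _ = _ (+) X]IH addbC; congr (_ (+) _).
by congr oct; apply/funext => s /=; rewrite opprK.
Qed.

(** The induction on dimension of Borsuk-Ulam. The hemisphere of the simplices
    that start with [e i] has the sphere on the remaining axes as boundary. As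
    [phi true] and [phi false] are exchanged by the antipodal map, the sum of
    [phi true] over the sphere is the sum of [phi true + phi false] over that
    hemisphere, which is the sum of [cobd (phi true)] over it, hence the sum of
    [phi true] over the lower sphere. *)
Lemma oct_odd (phi : bool -> seq V -> bool) ix :
    (forall b, phi b [::] = true) ->
    (forall ix, uniq ix -> {in oct_simplices ix, forall s,
        phi true (map -%R s) = phi false s /\
        cobd (phi true) s = phi true s (+) phi false s}) ->
  uniq ix -> oct ix (phi true) = true.
Proof.
move=> phi0 phiP; elim: ix => [|i ix IH] //= uix; have /andP[_ /IH ih] := uix.
transitivity (oct ix (phi true)) => //.
rewrite -[X in _ (+) X]oct_opp -octD.
transitivity (oct ix (fun s => cobd (phi true) (e i :: s))).
  apply: eq_oct => s ss.
  have /(phiP (i :: ix) uix)[] : e i :: s \in oct_simplices (i :: ix).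
    by rewrite /= mem_cat map_f.
  by rewrite /= => -> ->.
by rewrite /= octD oct_cobd addbF.
Qed.

End Octahedral.

(** * An approximate Borsuk-Ulam theorem *)

Section OctahedralSphere.
Context {R : realType} {n : nat}.

Definition basis_vec (i : 'I_n) : 'rV[R]_n := delta_mx ord0 i.

Lemma oct_simplices_size ix s : s \in oct_simplices basis_vec ix ->
  size s = size ix.
Proof.
elim: ix s => [|i ix IH] s /=; first by rewrite inE => /eqP->.
by rewrite mem_cat => /orP[] /mapP[t /IH <- ->].
Qed.

Lemma enorm_basis_vec i : enorm (basis_vec i) = 1.
Proof.
rewrite /enorm (bigD1 i)//= big1 ?addr0 => [|j /negPf ji].
  by rewrite mxE !eqxx expr1n sqrtr1.
by rewrite mxE ji andbF expr0n.
Qed.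

Lemma oct_simplices_enorm ix s x : s \in oct_simplices basis_vec ix ->
  x \in s -> enorm x = 1.
Proof.
elim: ix s => [|i ix IH] s /=; first by rewrite inE => /eqP->.
rewrite mem_cat => /orP[] /mapP[t /IH e ->].
  by rewrite inE => /predU1P[->|/e//]; rewrite enorm_basis_vec.
by rewrite inE => /predU1P[->|/e//]; rewrite enormN enorm_basis_vec.
Qed.

Lemma oct_simplices_sign ix s : uniq ix -> s \in oct_simplices basis_vec ix ->
  exists sg : 'I_n -> bool, s = [seq (-1) ^+ sg i *: basis_vec i | i <- ix].
Proof.
elim: ix s => [|i ix IH] s /=.
  by move=> _; rewrite inE => /eqP->; exists (fun=> false).
move=> /andP[iix uix]; rewrite mem_cat => ss.
have [b [t ts ->]] : exists b : bool,
    exists2 t, t \in oct_simplices basis_vec ix &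
    s = (-1) ^+ b *: basis_vec i :: t.
  case/orP: ss => /mapP[t ts ->]; [exists false|exists true]; exists t => //.
    by rewrite expr0 scale1r.
  by rewrite expr1 scaleN1r.
have [sg ->] := IH _ uix ts.
exists (fun j : 'I_n => if j == i then b else sg j).
rewrite eqxx; congr (_ :: _).
apply/eq_in_map => j jix; case: eqP => // ji.
by move: iix; rewrite -ji jix.
Qed.

(** Each face of the cross-polytope lies in an affine hyperplane that avoids
    the origin, which keeps the points of its subdivisions away from 0. *)
Lemma oct_simplices_face ix s : uniq ix -> s \in oct_simplices basis_vec ix ->
  exists sg : 'I_n -> bool,
    {in s, forall x : 'rV_n, \sum_i (-1) ^+ sg i * x ord0 i = 1}.
Proof.
move=> uix /(oct_simplices_sign uix)[sg ->]; exists sg => _ /mapP[j _ ->].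
rewrite (bigD1 j)//= big1 ?addr0 => [|i /negPf ij].
  by rewrite !mxE !eqxx mulr1 -signr_addb addbb.
by rewrite !mxE ij andbF !mulr0.
Qed.

End OctahedralSphere.

(** The effect of the antipodal map on pairs [(f x, f (- x))]. *)
Definition swap_pair (T : Type) (p : T * T) := (p.2, p.1).

HB.instance Definition _ (R : pzRingType) (V : lmodType R) :=
  GRing.isLinear.Build R (V * V)%type (V * V)%type *:%R (@swap_pair V)
    (fun _ _ _ => erefl).

Lemma exists_expr_le (R : realType) (c D e : R) :
  0 <= c < 1 -> 0 < e -> exists k, c ^+ k * D <= e.
Proof.
move=> /andP[c0 c1] e0.
have h : ((fun k => c ^+ k * D) @ \oo --> (0 : R))%classic.
  suff : ((fun k => c ^+ k * D) @ \oo --> 0 * D)%classic by rewrite mul0r.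
  by apply: cvgMl; apply: cvg_expr; rewrite ger0_norm.
have /cvgrPdist_le/(_ _ e0)[k _ /(_ k (leqnn k))] := h.
by rewrite /= sub0r normrN => ke; exists k; rewrite (le_trans (ler_norm _)).
Qed.

(** Subdivide the octahedral sphere [K] times to make the mesh at most [e];
    send its vertices to pairs [(f x, f (- x))]; subdivide the resulting
    simplices of pairs [L] times to make the mesh of the differences small
    compared with [h]. If the difference [a - b] were longer than [h] at every
    vertex [(a, b)], labelling it by the side of its largest coordinate would
    never produce opposite labels in a simplex. Then [oct_odd] would count an
    odd number of alternating simplices with [n.+2] vertices, whereas there are
    only [n.+1] axes. Membership of [(a, b)] in the hull of the pairs is
    expressed by quantifying over convex sets, the form in which subdivision
    preserves it. *)
Theorem approximate_borsuk_ulam (R : realType) (n : nat)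
    (f : 'rV[R]_n.+2 -> 'rV[R]_n.+1) (M e h : R) :
    (forall x, enorm (f x) <= M) -> 0 < e -> 0 < h ->
  exists (s : seq 'rV[R]_n.+2) (a b : 'rV[R]_n.+1),
    [/\ {in s, forall x, 1 <= n.+2%:R * enorm x},
        {in s &, forall x y, enorm (x - y) <= e},
        (forall C : set ('rV[R]_n.+1 * 'rV[R]_n.+1), convex_set C ->
          {in s, forall x, C (f x, f (- x))} -> C (a, b)) &
        enorm (a - b) <= h].
Proof.
move=> fM e0 h0; apply: contrapT => H.
pose W := ('rV[R]_n.+1 * 'rV[R]_n.+1)%type.
pose gap (p : W) := p.1 - p.2.
pose F x : W := (f x, f (- x)).
pose c : R := n.+1%:R / n.+2%:R.
have c01 : 0 <= c < 1.
  by rewrite divr_ge0//= ltr_pdivrMr ?ltr0n// mul1r ltr_nat.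
(* 2 bounds the diameter of a simplex of the octahedral sphere, and 4 M that of
   the set of differences f x - f (- x). *)
have [K Ke] := @exists_expr_le _ _ 2 _ c01 e0.
have h'0 : 0 < h / n.+2%:R by rewrite divr_gt0// ltr0n.
have [L Lh] := @exists_expr_le _ _ (4 * M) _ c01 h'0.
pose psi b := iter_subdiv L (alternates b \o map (label \o gap)).
pose Phi b := iter_subdiv K (psi b \o map F).
(* H, the negation of the conclusion, read on the fine simplices u of pairs. *)
have good ix s t u : uniq ix -> s \in oct_simplices basis_vec ix ->
    iter_subdivides K s t -> iter_subdivides L (map F t) u ->
    {in u, forall p, h < enorm (gap p)} /\
    {in map (label \o gap) u &, injective half}.
  move=> uix ss st tu.
  have sn : (size s <= n.+2)%N.
    rewrite (oct_simplices_size ss) -(card_uniqP uix).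
    by rewrite (leq_trans (max_card _))// card_ord.
  have tn : {in t, forall x, 1 <= n.+2%:R * enorm x}.
    have [sg sgs] := oct_simplices_face uix ss.
    suff sgt : {in t, forall x : 'rV_n.+2, \sum_i (-1) ^+ sg i * x ord0 i = 1}.
      move=> x xt; rewrite -[leLHS](sgt x xt).
      have <- : \sum_(i < n.+2) enorm x = n.+2%:R * enorm x.
        by rewrite sumr_const card_ord mulr_natl.
      apply: ler_sum => i _; rewrite (le_trans (ler_norm _))//.
      by rewrite normrM normr_sign mul1r coord_le_enorm.
    have := @iter_subdivides_convex R _
      [set x : 'rV_n.+2 | \sum_i (-1) ^+ sg i * x ord0 i = 1]%classic K s t.
    apply => //; apply/convex_setP => x y p _ _ /= x1 y1.
    under eq_bigr do rewrite !mxE mulrDr mulrCA [X in _ + X]mulrCA.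
    by rewrite big_split/= -!mulr_sumr x1 y1 !mulr1 addrC subrK.
  have te : {in t &, forall x y, enorm (x - y) <= e}.
    move=> x y xt yt; apply: le_trans Ke; move: x y xt yt.
    apply: (iter_subdivides_mesh (N := @enorm R _) _ _ sn st) => [||x y xs ys].
    - exact: ler_enormD.
    - exact: enormZ.
    - rewrite (le_trans (ler_enormD _ _))// enormN.
      by rewrite !(oct_simplices_enorm ss)//; lra.
  have uh : {in u, forall p, h < enorm (gap p)}.
    move=> [a b] pu; rewrite ltNge; apply/negP => abh; apply: H.
    exists t, a, b; split => // C cC Ct.
    apply: (iter_subdivides_convex cC tu) pu => _ /mapP[x xt ->]; exact: Ct.
  split=> // _ _ /mapP[p pu ->] /mapP[q qu ->]; apply: label_inj.
  rewrite (lt_trans _ (uh _ pu))// -ltr_pdivlMr ?ltr0n//.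
  have -> : gap p - gap q = gap (p - q).
    by rewrite /gap opprD addrACA -opprD.
  apply: (@le_lt_trans _ _ (h / n.+2%:R)); last first.
    by rewrite ltr_pM2l// ltf_pV2 ?posrE ?ltr0n// ltr_nat.
  apply: le_trans Lh; move: p q pu qu.
  have szt : (size (map F t) <= n.+2)%N.
    by rewrite size_map (iter_subdivides_size st).
  apply: (iter_subdivides_mesh (N := fun p : W => enorm (gap p)) _ _ szt tu).
  - move=> p q; rewrite (le_trans _ (ler_enormD _ _))//.
    by rewrite /gap /= opprD addrACA.
  - by move=> a p; rewrite /gap /= -scalerBr enormZ.
  - move=> _ _ /mapP[x _ ->] /mapP[y _ ->]; rewrite /gap /=.
    rewrite (le_trans (ler_enormD _ _))// enormN.
    have := ler_enormD (f x) (- f y); have := ler_enormD (f (- x)) (- f (- y)).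
    rewrite !enormN; have := fM x; have := fM y; have := fM (- x).
    by have := fM (- y); lra.
have : oct basis_vec (enum 'I_n.+2) (Phi true) = true.
  apply: oct_odd; last exact: enum_uniq.
    by move=> b; rewrite /Phi iter_subdiv_nil /= /psi iter_subdiv_nil.
  move=> ix uix s ss; split.
    rewrite /Phi iter_subdiv_map; apply: eq_iter_subdiv => t st /=.
    have -> : map F (map -%R t) = map (@swap_pair _) (map F t).
      by rewrite -!map_comp; apply: eq_map => x; rewrite /F /= opprK.
    rewrite /psi iter_subdiv_map; apply: eq_iter_subdiv => u tu /=.
    have [uh uinj] := good _ _ _ _ uix ss st tu.
    rewrite -[false]/(~~ true) -alternates_opposite// -!map_comp.
    congr alternates; apply/eq_in_map => p /uh ph /=.
    rewrite -labelN; first by rewrite /gap opprB.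
    by apply: contraTneq ph => ->; rewrite enorm0 -leNgt ltW.
  rewrite cobd_iter_subdiv -iter_subdivD; apply: eq_iter_subdiv => t st.
  rewrite -cobd_map cobd_iter_subdiv -iter_subdivD.
  apply: eq_iter_subdiv => u tu; rewrite -cobd_map.
  have [_ uinj] := good _ _ _ _ uix ss st tu.
  exact: cobd_alternates.
rewrite (@eq_oct _ _ _ _ _ (fun=> false)).
  by rewrite -(addbb false) octD addbb.
move=> s ss; rewrite -[RHS](iter_subdiv0 K s); apply: eq_iter_subdiv => t st.
rewrite /= -[RHS](iter_subdiv0 L (map F t)); apply: eq_iter_subdiv => u tu /=.
apply/negbTE/negP => /(@alternates_size n.+1) le_n.
have : (n.+2 <= n.+1)%N; last by rewrite ltnn.
rewrite -{1}(size_enum_ord n.+2) -(oct_simplices_size ss).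
rewrite -(iter_subdivides_size st) -(size_map F) -(iter_subdivides_size tu).
rewrite -(size_map (label \o gap)); apply: le_n.
by move=> _ /mapP[p _ ->]; rewrite half_label.
Qed.

(** * Reduction of the number of points *)

Definition support_size (R : realFieldType) (k : nat) (w : 'rV[R]_k) : nat :=
  \sum_i (w ord0 i != 0)%R.

Section Caratheodory.
Context {R : realFieldType} {k N : nat}.
Implicit Types (w : 'rV[R]_k) (A : 'M[R]_(k, N)).

(** The rows of [A] indexed by the support of [w] are more than [N] vectors in
    a space of dimension [N]. *)
Lemma dependence_in_support A w : (N < support_size w)%N ->
  exists u : 'rV[R]_k, [/\ u *m A = 0, (exists i, 0 < u ord0 i) &
    forall i, w ord0 i = 0 -> u ord0 i = 0].
Proof.
pose S := [set i | w ord0 i != 0].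
have -> : support_size w = #|S|.
  rewrite /support_size -sum1_card [RHS]big_mkcond /=.
  by apply: eq_bigr => i _; rewrite inE; case: (w ord0 i == 0).
move=> NS; pose E : 'M[R]_(#|S|, k) := \matrix_(l, i) (enum_val l == i)%:R.
have : kermx (E *m A) != 0.
  rewrite -mxrank_eq0 mxrank_ker subn_eq0 -ltnNge.
  exact: leq_ltn_trans (rank_leq_col _) NS.
case/rowV0Pn => v /sub_kermxP vEA v0.
have uE i : (v *m E) ord0 i = \sum_l v ord0 l * (enum_val l == i)%:R.
  by rewrite mxE; apply: eq_bigr => l _; rewrite mxE.
have uE1 l : (v *m E) ord0 (enum_val l) = v ord0 l.
  rewrite uE (bigD1 l)//= eqxx mulr1 big1 ?addr0// => j jl.
  by rewrite (inj_eq enum_val_inj) (negPf jl) mulr0.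
have uS i : w ord0 i = 0 -> (v *m E) ord0 i = 0.
  move=> wi; rewrite uE big1// => l _.
  case: eqP => [li|]; last by rewrite mulr0.
  by have := enum_valP l; rewrite li inE wi eqxx.
have [l vl] : exists l, v ord0 l != 0.
  apply/existsP; apply: contraNT v0 => /existsPn h.
  by apply/eqP/rowP => l; rewrite mxE; apply/eqP/negPn.
have [vl0|vl0|vl0] := ltrgtP (v ord0 l) 0; last by rewrite vl0 eqxx in vl.
- exists (- (v *m E)); split; first by rewrite mulNmx -mulmxA vEA oppr0.
    by exists (enum_val l); rewrite mxE uE1 oppr_gt0.
  by move=> i /uS ui; rewrite mxE ui oppr0.
- exists (v *m E); split=> //; first by rewrite -mulmxA.
  by exists (enum_val l); rewrite uE1.
Qed.

(** Moving from [w] against a dependence [u] supported in the support of [w],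
    until a coordinate vanishes for the first time, keeps [w *m A] and shrinks
    the support. *)
Lemma caratheodory A w : (forall i, 0 <= w ord0 i) ->
  exists w' : 'rV[R]_k, [/\ (forall i, 0 <= w' ord0 i), w' *m A = w *m A &
    (support_size w' <= N)%N].
Proof.
have [d] := ubnP (support_size w); elim: d w => // d IH w.
rewrite ltnS => wd w0.
have [?|] := leqP (support_size w) N; first by exists w.
move=> /(dependence_in_support A)[u [uA [i0 ui0] uw]].
(* j is the coordinate that vanishes first along w - t u. *)
pose j := [arg min_(i < i0 | 0 < u ord0 i) (w ord0 i / u ord0 i)]%O.
have [uj jmin] : 0 < u ord0 j /\ forall i, 0 < u ord0 i ->
    w ord0 j / u ord0 j <= w ord0 i / u ord0 i.
  by rewrite /j; case: arg_minP.
set t := w ord0 j / u ord0 j in jmin.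
have t0 : 0 <= t by rewrite divr_ge0// ltW.
have [|i|w' [w'0 w'A w'N]] := IH (w - t *: u).
- have wj : w ord0 j != 0 by apply: contraTneq uj => /uw ->; rewrite ltxx.
  apply: leq_trans wd; rewrite /support_size (bigD1 j)//= [ltnRHS](bigD1 j)//=.
  have uj' : u ord0 j != 0 by rewrite gt_eqF.
  rewrite !mxE /t divfK// subrr eqxx wj ltnS leq_sum// => i _.
  rewrite !mxE; have [wi|_] := eqVneq (w ord0 i) 0; last exact: leq_b1.
  by rewrite wi (uw _ wi) mulr0 subrr eqxx.
- rewrite !mxE subr_ge0; have [ui|ui] := ltrP 0 (u ord0 i).
    by rewrite -ler_pdivlMr// jmin.
  by rewrite (le_trans _ (w0 i))// mulr_ge0_le0.
exists w'; split=> //.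
by rewrite w'A mulmxBl -scalemxAl uA scaler0 subr0.
Qed.

End Caratheodory.

(** * Close points of two sets whose hulls meet *)

(** The squared distance between the vertices of two regular simplices of edge
    1, with [n./2.+1] and [(uphalf n).+1] vertices, a common centre and
    orthogonal directions: [(1 - 1/k) / 2] is the squared circumradius of such
    a simplex with [k] vertices. *)
Definition alpha_sqr (R : realType) (n : nat) : R :=
  1 - ((n./2).+1%:R^-1 + (uphalf n).+1%:R^-1) / 2.

Section CloseWeights.
Context {R : realType} {n : nat}.

Lemma alpha_sqr_ge0 : 0 <= alpha_sqr R n.
Proof.
have h k : (k.+1%:R^-1 : R) <= 1 by rewrite invf_le1 ?ltr0n// ler1n.
rewrite /alpha_sqr; move: (h n./2) (h (uphalf n)).
by move: (_%:R^-1) (_%:R^-1) => a b; lra.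
Qed.

(** Enlarging [q] to [q'] so that [p + q' = n.+2] decreases the right-hand
    side, which is then [n.+2 / (p * q')] and smallest for the balanced
    splitting. *)
Lemma inv_sum_ge (p q : nat) : (0 < p)%N -> (0 < q)%N -> (p + q <= n.+2)%N ->
  (n./2).+1%:R^-1 + (uphalf n).+1%:R^-1 <= p%:R^-1 + q%:R^-1 :> R.
Proof.
move=> p0 q0 pq; pose q' := (n.+2 - p)%N.
apply: (@le_trans _ _ (p%:R^-1 + q'%:R^-1)); last first.
  by rewrite lerD2l lef_pV2 ?posrE ?ltr0n ?ler_nat//; lia.
have invD (a b : nat) : (0 < a)%N -> (0 < b)%N -> (a + b = n.+2)%N ->
    a%:R^-1 + b%:R^-1 = n.+2%:R / (a * b)%:R :> R.
  move=> a0 b0 <-; rewrite natrD natrM; field.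
  by rewrite !pnatr_eq0 -!lt0n a0 b0.
rewrite !invD//; try lia.
have q'0 : (0 < q')%N by lia.
rewrite ler_pM2l ?ltr0n// lef_pV2 ?posrE ?ltr0n ?muln_gt0 ?p0// ler_nat.
(* Write y = x + d: both factors on the right differ from x by a half of d. *)
have le_mul (x y : nat) : (x <= y)%N -> (x + y = n.+2)%N ->
    (x * y <= n./2.+1 * (uphalf n).+1)%N.
  move=> /subnK <-; move: (y - x)%N => d xn.
  have -> : n./2.+1 = (x + d./2)%N by lia.
  have -> : (uphalf n).+1 = (x + uphalf d)%N by lia.
  have : d = (d./2 + uphalf d)%N by lia.
  by move: (d./2) (uphalf d) => a b ->; nia.
have [pq'|/ltnW q'p] := leqP p q'; first by apply: le_mul => //; lia.
by rewrite mulnC; apply: le_mul => //; lia.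
Qed.

(** The squared distance from [w] to the uniform weights on its support is
    nonnegative. *)
Lemma sum_sqr_ge p (w : 'rV[R]_p) : \sum_i w ord0 i = 1 ->
  (0 < support_size w)%N /\ (support_size w)%:R^-1 <= \sum_i w ord0 i ^+ 2.
Proof.
move=> w1; have s0 : (0 < support_size w)%N.
  rewrite lt0n; apply/eqP => /eqP; rewrite sum_nat_eq0 => /forallP h.
  move: w1; rewrite big1 => [/esym/eqP|i _]; first by rewrite oner_eq0.
  by have := h i; rewrite eqb0 negbK => /eqP.
split=> //; set s := support_size w.
have : 0 <= \sum_i (w ord0 i - (w ord0 i != 0)%:R / s%:R) ^+ 2.
  by apply: sumr_ge0 => i _; exact: sqr_ge0.
have -> : \sum_i (w ord0 i - (w ord0 i != 0)%:R / s%:R) ^+ 2 =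
    \sum_i w ord0 i ^+ 2 - 2 / s%:R * \sum_i w ord0 i +
    s%:R^-1 ^+ 2 * \sum_i (w ord0 i != 0)%:R.
  rewrite !mulr_sumr -sumrN -!big_split /=; apply: eq_bigr => i _.
  by case: eqP => [->|_] /=; ring.
rewrite -natr_sum -/(support_size w) -/s w1.
have s0' : s%:R != 0 :> R by rewrite pnatr_eq0 -lt0n.
have -> : s%:R^-1 ^+ 2 * s%:R = s%:R^-1 :> R by field.
by lra.
Qed.

Lemma sum_sqr_diff p q (l x : 'I_p -> R) (m y : 'I_q -> R) :
  \sum_i \sum_j l i * m j * (x i - y j) ^+ 2 =
    (\sum_i l i * x i ^+ 2) * (\sum_j m j)
    - 2 * (\sum_i l i * x i) * (\sum_j m j * y j)
    + (\sum_i l i) * (\sum_j m j * y j ^+ 2).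
Proof.
have E i : \sum_j l i * m j * (x i - y j) ^+ 2 =
    l i * x i ^+ 2 * (\sum_j m j) - 2 * (l i * x i) * (\sum_j m j * y j)
    + l i * (\sum_j m j * y j ^+ 2).
  rewrite !mulr_sumr -sumrB -big_split /=.
  by apply: eq_bigr => j _; ring.
under eq_bigr do rewrite E.
by rewrite big_split /= sumrB -!mulr_suml -mulr_sumr.
Qed.

Definition weights p (l : 'rV[R]_p) :=
  (forall i, 0 <= l ord0 i) /\ \sum_i l ord0 i = 1.

(** For independent random vectors [x] and [y] with equal means, the mean of
    [|x - y|^2] is the sum of the variances of [x] and [y], each of which is
    half the mean of the squared distance between two independent copies. It is
    checked coordinate by coordinate. *)
Lemma weighted_sqr_dist p q (X : 'M[R]_(p, n)) (Y : 'M[R]_(q, n))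
    (l : 'rV[R]_p) (m : 'rV[R]_q) :
    \sum_i l ord0 i = 1 -> \sum_j m ord0 j = 1 -> l *m X = m *m Y ->
  \sum_i \sum_j l ord0 i * m ord0 j * enorm (row i X - row j Y) ^+ 2 =
  (\sum_i \sum_j l ord0 i * l ord0 j * enorm (row i X - row j X) ^+ 2 +
   \sum_i \sum_j m ord0 i * m ord0 j * enorm (row i Y - row j Y) ^+ 2) / 2.
Proof.
move=> l1 m1 lm.
have E a b (u : 'rV[R]_a) (v : 'rV[R]_b) (A : 'M[R]_(a, n)) (B : 'M[R]_(b, n)) :
    \sum_i \sum_j u ord0 i * v ord0 j * enorm (row i A - row j B) ^+ 2 =
    \sum_c \sum_i \sum_j u ord0 i * v ord0 j * (A i c - B j c) ^+ 2.
  rewrite [RHS]exchange_big /=; apply: eq_bigr => i _.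
  rewrite [RHS]exchange_big /=; apply: eq_bigr => j _.
  by rewrite sqr_enorm mulr_sumr; apply: eq_bigr => c _; rewrite !mxE.
rewrite !E -big_split /= mulr_suml; apply: eq_bigr => c _.
rewrite !sum_sqr_diff l1 m1.
have : (l *m X) ord0 c = (m *m Y) ord0 c by rewrite lm.
by rewrite !mxE => ->; field.
Qed.

(** The diagonal terms vanish; the weights off the diagonal sum to [1 - \sum_i
    l i ^+ 2]. *)
Lemma weighted_sqr_diam p (X : 'M[R]_(p, n)) (l : 'rV[R]_p) D : weights l ->
    (forall i j, enorm (row i X - row j X) <= D) ->
  (0 < support_size l)%N /\
  \sum_i \sum_j l ord0 i * l ord0 j * enorm (row i X - row j X) ^+ 2 <=
    D ^+ 2 * (1 - (support_size l)%:R^-1).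
Proof.
move=> [l0 l1] XD; have [s0 sq] := sum_sqr_ge l1; split=> //.
apply: (@le_trans _ _ (D ^+ 2 * (1 - \sum_i l ord0 i ^+ 2))); last first.
  by rewrite ler_wpM2l ?sqr_ge0// lerD2l lerN2.
have -> : 1 - \sum_i l ord0 i ^+ 2 =
    \sum_i \sum_j l ord0 i * l ord0 j * (i != j)%:R.
  rewrite -{1}l1 -sumrN -big_split /=; apply: eq_bigr => i _.
  rewrite [RHS](bigD1 i)//= eqxx mulr0 add0r expr2 -{1}[l ord0 i]mulr1 -mulrBr.
  rewrite -{1}l1 [X in X - _](bigD1 i)//= addrAC subrr add0r mulr_sumr.
  by apply: eq_bigr => j; rewrite eq_sym => ->; rewrite mulr1.
rewrite mulr_sumr ler_sum// => i _; rewrite mulr_sumr ler_sum// => j _.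
rewrite [leRHS]mulrCA ler_wpM2l ?mulr_ge0//; have [->|ij] := eqVneq i j.
  by rewrite subrr enorm0 expr0n mulr0.
by rewrite mulr1 lerXn2r ?nnegrE ?enorm_ge0// (le_trans (enorm_ge0 _) (XD i j)).
Qed.

(** There are [n.+2] linear constraints to preserve: the [n] coordinates of the
    common point and the two total weights. *)
Lemma weights_caratheodory p q (X : 'M[R]_(p, n)) (Y : 'M[R]_(q, n))
    (l : 'rV[R]_p) (m : 'rV[R]_q) :
    weights l -> weights m -> l *m X = m *m Y ->
  exists l' m', [/\ weights l', weights m', l' *m X = m' *m Y &
    (support_size l' + support_size m' <= n.+2)%N].
Proof.
move=> [l0 l1] [m0 m1] lm.
(* The rows of A are (x_i, 1, 0) and (- y_j, 0, 1). *)
pose A : 'M[R]_(p + q, n + (1 + 1)) := col_mx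
  (row_mx X (row_mx (const_mx 1) 0)) (row_mx (- Y) (row_mx 0 (const_mx 1))).
have sum1 k (v : 'rV[R]_k) :
    v *m const_mx 1 = (\sum_i v ord0 i)%:M :> 'M[R]_(1, 1).
  apply/matrixP => i j; rewrite !mxE !ord1 eqxx mulr1n.
  by apply: eq_bigr => c _; rewrite mxE mulr1.
have AE (u : 'rV[R]_p) (v : 'rV[R]_q) : row_mx u v *m A =
    row_mx (u *m X - v *m Y)
      (row_mx (\sum_i u ord0 i)%:M (\sum_i v ord0 i)%:M).
  rewrite mul_row_col !mul_mx_row add_row_mx mulmxN add_row_mx.
  by rewrite !mulmx0 addr0 add0r !sum1.
have [i|w [w0 wA wN]] := @caratheodory _ _ _ A (row_mx l m).
  by rewrite mxE; case: fintype.split.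
rewrite -[w]hsubmxK !AE in wA.
set l' := lsubmx w in wA; set m' := rsubmx w in wA.
have [XY /eq_row_mx[l'1 m'1]] := eq_row_mx wA.
have scal (a b : R) : a%:M = b%:M :> 'M[R]_(1, 1) -> a = b.
  by move=> /matrixP/(_ ord0 ord0); rewrite !mxE eqxx !mulr1n.
exists l', m'; split.
- by split=> [i|]; [rewrite mxE|rewrite (scal _ _ l'1)].
- by split=> [i|]; [rewrite mxE|rewrite (scal _ _ m'1)].
- by apply/eqP; rewrite -subr_eq0 XY lm subrr.
- move: wN; rewrite /support_size big_split_ord /= addn2; apply: leq_trans.
  by apply: eq_leq; congr (_ + _)%N; apply: eq_bigr => i _; rewrite mxE.
Qed.

(** Otherwise the weighted mean of [|x - y|^2] would exceed the bound that
    [weighted_sqr_dist] and [weighted_sqr_diam] put on it. *)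
Lemma weights_close_rows p q (X : 'M[R]_(p, n)) (Y : 'M[R]_(q, n))
    (l : 'rV[R]_p) (m : 'rV[R]_q) D :
    weights l -> weights m -> l *m X = m *m Y ->
    (forall i j, enorm (row i X - row j X) <= D) ->
    (forall i j, enorm (row i Y - row j Y) <= D) ->
  exists i j, enorm (row i X - row j Y) <= Num.sqrt (alpha_sqr R n) * D.
Proof.
move=> lw mw lm XD YD.
have [{lw mw lm}l [{}m [lw mw lm pq]]] := weights_caratheodory lw mw lm.
have [p0 Xl] := weighted_sqr_diam lw XD.
have [q0 Ym] := weighted_sqr_diam mw YD.
apply: contrapT => H.
have far i j : alpha_sqr R n * D ^+ 2 < enorm (row i X - row j Y) ^+ 2.
  have D0 : 0 <= D by rewrite (le_trans (enorm_ge0 _) (XD i i)).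
  rewrite -[alpha_sqr R n]sqr_sqrtr ?alpha_sqr_ge0// -exprMn.
  rewrite ltr_pXn2r ?nnegrE ?mulr_ge0 ?sqrtr_ge0 ?enorm_ge0// ltNge.
  by apply/negP => XY; apply: H; exists i, j.
have [[l0 l1] [m0 m1]] := (lw, mw).
have := weighted_sqr_dist l1 m1 lm.
set S := \sum_i \sum_j _ => SE.
have SD : S <= alpha_sqr R n * D ^+ 2.
  have := inv_sum_ge p0 q0 pq; move: Xl Ym; rewrite SE /alpha_sqr.
  set a := _%:R^-1; set b := _%:R^-1; set c := _%:R^-1; set d := _%:R^-1.
  move=> Xl Ym abcd; have := sqr_ge0 D => D0.
  have : D ^+ 2 * (c + d) <= D ^+ 2 * (a + b) by rewrite ler_wpM2l.
  move: Xl Ym; move: (\sum_i \sum_j _) (\sum_i \sum_j _) => u v.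
  by move: (D ^+ 2) => DD; lra.
have T0 i j : 0 <= l ord0 i * m ord0 j *
    (enorm (row i X - row j Y) ^+ 2 - alpha_sqr R n * D ^+ 2).
  by rewrite mulr_ge0 ?mulr_ge0// subr_ge0 ltW.
have : \sum_i \sum_j l ord0 i * m ord0 j *
    (enorm (row i X - row j Y) ^+ 2 - alpha_sqr R n * D ^+ 2) <= 0.
  under eq_bigr do under eq_bigr do rewrite mulrBr.
  under eq_bigr do rewrite sumrB -mulr_suml -mulr_sumr m1 mulr1.
  by rewrite sumrB -mulr_suml l1 mul1r subr_le0.
rewrite le_eqVlt ltNge sumr_ge0 ?orbF => [|i _]; last exact: sumr_ge0.
rewrite psumr_eq0 => [/allP T|i _]; last exact: sumr_ge0.
have lm0 i j : l ord0 i * m ord0 j = 0.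
  have := T i (mem_index_enum _); rewrite psumr_eq0//.
  move=> /allP/(_ j (mem_index_enum _)); rewrite mulf_eq0 => /orP[/eqP//|].
  by rewrite subr_eq0 gt_eqF.
have : (\sum_i l ord0 i) * (\sum_j m ord0 j) = 0.
  rewrite mulr_suml big1// => i _; rewrite mulr_sumr big1// => j _; exact: lm0.
by rewrite l1 m1 mul1r => /eqP; rewrite oner_eq0.
Qed.

End CloseWeights.

Section Hull.
Context {R : realType} {n : nat}.
Implicit Types (s t : seq 'rV[R]_n) (a : 'rV[R]_n).

Definition rows_of s : 'M[R]_(size s, n) := \matrix_(i < size s) s`_i.

Lemma conv_hull_weights s a : conv_hull [set` s]%classic a ->
  exists2 l : 'rV[R]_(size s), weights l & a = l *m rows_of s.
Proof.
move=> /(_ [set a | exists2 l : 'rV[R]_(size s),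
  weights l & a = l *m rows_of s]%classic); apply.
  apply/convex_setP => _ _ p p0 p1 [l [l0 l1] ->] [m [m0 m1] ->].
  exists (p *: l + (1 - p) *: m); last by rewrite mulmxDl -!scalemxAl.
  split=> [i|]; first by rewrite !mxE addr_ge0// mulr_ge0// subr_ge0.
  under eq_bigr do rewrite !mxE.
  by rewrite big_split /= -!mulr_sumr l1 m1 !mulr1 addrC subrK.
move=> x /= xs; have xi : (index x s < size s)%N by rewrite index_mem.
exists (delta_mx ord0 (Ordinal xi)).
  split=> [i|]; first by rewrite mxE ler0n.
  rewrite (bigD1 (Ordinal xi))//= big1 ?addr0 ?mxE ?eqxx// => i /negPf ix.
  by rewrite mxE ix andbF.
by rewrite -rowE rowK nth_index.
Qed.

Lemma hulls_meet_close s t a (D : R) :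
    conv_hull [set` s]%classic a -> conv_hull [set` t]%classic a ->
    {in s &, forall x y, enorm (x - y) <= D} ->
    {in t &, forall x y, enorm (x - y) <= D} ->
  exists x y, [/\ x \in s, y \in t &
    enorm (x - y) <= Num.sqrt (alpha_sqr R n) * D].
Proof.
move=> /conv_hull_weights[l lw ->] /conv_hull_weights[m mw lm] sD tD.
have [i j|i j|i [j ij]] := weights_close_rows (D := D) lw mw lm.
- by rewrite !rowK sD// mem_nth.
- by rewrite !rowK tD// mem_nth.
- exists s`_i, t`_j; rewrite !mem_nth//; split=> //.
  by move: ij; rewrite !rowK.
Qed.

Lemma has_ubound_dist s t :
  has_ubound [set enorm (x - y) | x in [set` s] & y in [set` t]]%classic.
Proof.
exists (\sum_(x <- s) \sum_(y <- t) enorm (x - y)) => _ [x xs [y yt <-]].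
rewrite (perm_big _ (perm_to_rem xs)) big_cons /=.
rewrite (perm_big _ (perm_to_rem yt)) big_cons /= -addrA lerDl.
rewrite addr_ge0 ?sumr_ge0// => [z _|z _]; first exact: enorm_ge0.
by rewrite sumr_ge0// => u _; exact: enorm_ge0.
Qed.

Lemma dist_le_diam s :
  {in s &, forall x y, enorm (x - y) <= diam [set` s]%classic}.
Proof.
move=> x y xs ys; apply: (ub_le_sup (has_ubound_dist s s)).
by exists x => //; exists y.
Qed.

Lemma set_dist_le s t :
  {in s & t, forall x y,
    set_dist [set` s]%classic [set` t]%classic <= enorm (x - y)}.
Proof.
move=> x y xs yt; apply: ge_inf; last by exists x => //; exists y.
by exists 0 => _ [u _ [v _ <-]]; exact: enorm_ge0.
Qed.

Lemma set_dist_upper (X Y : set 'rV[R]_n) : finite_set X -> finite_set Y ->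
    diam X <= 1 -> diam Y <= 1 ->
    (conv_hull X `&` conv_hull Y !=set0)%classic ->
  set_dist X Y <= Num.sqrt (alpha_sqr R n).
Proof.
move=> /finite_seqP[s ->] /finite_seqP[t ->] s1 t1 [a [sa ta]].
have [x y xs ys|x y xt yt|x [y [xs yt xy]]] := hulls_meet_close (D := 1) sa ta.
- exact: le_trans (dist_le_diam xs ys) s1.
- exact: le_trans (dist_le_diam xt yt) t1.
- by rewrite mulr1 in xy; apply: le_trans (set_dist_le xs yt) xy.
Qed.

End Hull.

(** By induction on [k], as a pyramid over the simplex of the dimension below:
    the base is lowered by [t], and the apex is put at height [k.+1 * t] to
    keep the centroid at 0. *)
Lemma regular_simplex (R : realType) (k : nat) : exists s : seq 'rV[R]_k,
  [/\ size s = k.+1, \sum_(x <- s) x = 0,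
      {in s &, forall x y, enorm (x - y) <= 1} &
      {in s, forall x, enorm x ^+ 2 = (1 - k.+1%:R^-1) / 2}].
Proof.
elim: k => [|k [s [sk s0 s1 sr]]].
  exists [:: 0]; split=> [//||x y|x].
  - by rewrite big_seq1.
  - by rewrite !inE => /eqP-> /eqP->; rewrite subrr enorm0 ler01.
  - by rewrite inE => /eqP->; rewrite enorm0 invr1 subrr mul0r expr0n.
have k1 : k.+1%:R != 0 :> R by rewrite pnatr_eq0.
have k2 : k.+1%:R + 1 != 0 :> R by rewrite natr1 pnatr_eq0.
(* This t makes the distance from the apex to the base vertices equal to 1. *)
pose t : R := Num.sqrt (2 * k.+1%:R * (k.+1%:R + 1))^-1.
have t2 : t ^+ 2 = (2 * k.+1%:R * (k.+1%:R + 1))^-1.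
  by rewrite sqr_sqrtr// invr_ge0 !mulr_ge0// addr_ge0.
pose apex : 'rV[R]_(1 + k) := row_mx (const_mx (k.+1%:R * t)) 0.
pose base (x : 'rV[R]_k) : 'rV[R]_(1 + k) := row_mx (const_mx (- t)) x.
have sqc (c : R) : enorm (const_mx c : 'rV[R]_1) ^+ 2 = c ^+ 2.
  by rewrite sqr_enorm big_ord1 mxE.
have baseB x y : base x - base y = row_mx 0 (x - y).
  by rewrite /base opp_row_mx add_row_mx subrr.
have apexB x :
    enorm (apex - base x) ^+ 2 = ((k.+1%:R + 1) * t) ^+ 2 + enorm x ^+ 2.
  rewrite /apex /base opp_row_mx add_row_mx sqr_enorm_row_mx sub0r enormN.
  rewrite (_ : _ - _ = const_mx ((k.+1%:R + 1) * t)) ?sqc//.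
  by apply/matrixP => i j; rewrite !mxE; ring.
have apex_le x : x \in s -> enorm (apex - base x) <= 1.
  move=> xs; rewrite enorm_le_sqr// apexB (sr _ xs) expr1n exprMn t2.
  rewrite le_eqVlt; apply/orP; left; apply/eqP.
  by move: (k.+1%:R : R) k1 k2 => K k1 k2; field; rewrite k1 k2.
(* Row vectors of length k.+1 are regarded as blocks of lengths 1 and k. *)
change (exists s : seq 'rV[R]_(1 + k),
  [/\ size s = k.+2, \sum_(x <- s) x = 0,
      {in s &, forall x y, enorm (x - y) <= 1} &
      {in s, forall x, enorm x ^+ 2 = (1 - k.+2%:R^-1) / 2}]).
exists (apex :: map base s); split.
- by rewrite /= size_map sk.
- rewrite big_cons big_map.
  have -> : \sum_(x <- s) base x = row_mx (const_mx (- (k.+1%:R * t))) 0.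
    rewrite -s0 -sk; elim: s {s0 s1 sr sk apex_le} => [|x s IH].
      rewrite !big_nil; apply/matrixP => i j; rewrite !mxE /=.
      by case: fintype.split => ?; rewrite mxE ?mul0r ?oppr0.
    rewrite !big_cons IH add_row_mx; congr row_mx.
    by apply/matrixP => i j; rewrite !mxE /= -natr1; ring.
  rewrite /apex add_row_mx addr0 (_ : _ + _ = 0) ?row_mx0//.
  by apply/matrixP => i j; rewrite !mxE subrr.
- move=> _ _ /predU1P[->|/mapP[x xs ->]] /predU1P[->|/mapP[y ys ->]].
  + by rewrite subrr enorm0.
  + exact: apex_le.
  + by rewrite -enormN opprB apex_le.
  + rewrite baseB enorm_le_sqr// sqr_enorm_row_mx enorm0 expr0n add0r.
    by rewrite -enorm_le_sqr// s1.
- have E : (1 - k.+2%:R^-1) / 2 = (k.+1%:R * t) ^+ 2.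
    rewrite exprMn t2 -[k.+2%:R]natr1; 
    by move: (k.+1%:R : R) k1 k2 => K k1 k2; field; rewrite k1 k2.
  move=> _ /predU1P[->|/mapP[x xs ->]]; rewrite E sqr_enorm_row_mx sqc.
    by rewrite enorm0 expr0n addr0.
  rewrite (sr _ xs) sqrrN exprMn t2; 
    by move: (k.+1%:R : R) k1 k2 => K k1 k2; field; rewrite k1 k2.
Qed.

Lemma conv_hull_centroid (R : realType) n (s : seq 'rV[R]_n) : s != [::] ->
  \sum_(x <- s) x = 0 -> conv_hull [set` s]%classic 0.
Proof.
move=> sn s0 C cC sC; rewrite -(scaler0 _ (size s)%:R^-1) -s0.
by apply: (convex_barycenter cC sn) => x xs; exact: sC.
Qed.

Lemma diam_le (R : realType) n (s : seq 'rV[R]_n) (D : R) : s != [::] ->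
  {in s &, forall x y, enorm (x - y) <= D} -> diam [set` s]%classic <= D.
Proof.
case: s => // x s _ sD; apply: ge_sup.
  have xs : x \in x :: s by rewrite inE eqxx.
  by exists (enorm (x - x)), x => //; exists x.
by move=> _ [y ys [z zs <-]]; exact: sD.
Qed.

(** * The value of alpha *)

Section AlphaValue.
Context {R : realType}.

Local Notation admissible n := [set r : R | exists X Y : set 'rV[R]_n,
  [/\ finite_set X /\ finite_set Y, diam X <= 1, diam Y <= 1,
      conv_hull X `&` conv_hull Y !=set0 & r = set_dist X Y]]%classic.

Lemma orthogonal_simplices (n : nat) :
  admissible n (Num.sqrt (alpha_sqr R n)).
Proof.
have nE : n = (n./2 + uphalf n)%N by lia.
have [s [sk s0 s1 sr]] := regular_simplex R n./2.
have [t [tk t0 t1 tr]] := regular_simplex R (uphalf n).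
have : alpha_sqr R n =
    (1 - (n./2).+1%:R^-1) / 2 + (1 - (uphalf n).+1%:R^-1) / 2.
  rewrite /alpha_sqr; move: (n./2.+1%:R^-1 : R) ((uphalf n).+1%:R^-1 : R).
  by move=> a b; lra.
move: (alpha_sqr R n) => A AE; move: sk s0 s1 sr tk t0 t1 tr AE.
rewrite [in admissible n]nE; move: (n./2) (uphalf n) s t => {nE}p q s t.
move=> sk s0 s1 sr tk t0 t1 tr AE.
pose f (x : 'rV[R]_p) : 'rV[R]_(p + q) := row_mx x 0.
pose g (y : 'rV[R]_q) : 'rV[R]_(p + q) := row_mx 0 y.
have fn : map f s != [::] by rewrite -size_eq0 size_map sk.
have gn : map g t != [::] by rewrite -size_eq0 size_map tk.
exists [set` map f s]%classic, [set` map g t]%classic; split=> //.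
- apply: diam_le => // _ _ /mapP[x xs ->] /mapP[y ys ->].
  rewrite /f opp_row_mx add_row_mx subrr enorm_le_sqr// sqr_enorm_row_mx.
  by rewrite enorm0 expr0n addr0 -enorm_le_sqr// s1.
- apply: diam_le => // _ _ /mapP[x xs ->] /mapP[y ys ->].
  rewrite /g opp_row_mx add_row_mx subrr enorm_le_sqr// sqr_enorm_row_mx.
  by rewrite enorm0 expr0n add0r -enorm_le_sqr// t1.
- exists 0; split; apply: conv_hull_centroid => //; rewrite big_map.
    rewrite (eq_bigr (fun x => x *m row_mx 1%:M 0)) => [|x _].
      by rewrite -mulmx_suml s0 mul0mx.
    by rewrite mul_mx_row mulmx1 mulmx0.
  rewrite (eq_bigr (fun x => x *m row_mx 0 1%:M)) => [|x _].
    by rewrite -mulmx_suml t0 mul0mx.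
  by rewrite mul_mx_row mulmx1 mulmx0.
- rewrite /set_dist [X in inf X](_ : _ = [set Num.sqrt A]%classic) ?inf1//.
  have dE x y : x \in s -> y \in t -> enorm (f x - g y) = Num.sqrt A.
    move=> xs yt; rewrite AE -(sr _ xs) -(tr _ yt).
    rewrite -[enorm y]enormN -sqr_enorm_row_mx sqrtr_sqr ger0_norm ?enorm_ge0//.
    by rewrite /f /g opp_row_mx add_row_mx oppr0 addr0 add0r.
  apply/seteqP; split => [_ [_ /mapP[x xs ->] [_ /mapP[y yt ->] <-]]|_ ->] /=.
    exact: dE.
  have xs : s`_0 \in s by rewrite mem_nth ?sk.
  have yt : t`_0 \in t by rewrite mem_nth ?tk.
  exists (f s`_0); first exact: map_f.
  by exists (g t`_0); [exact: map_f|exact: dE].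
Qed.

Lemma alphaE (n : nat) : alpha R n = Num.sqrt (alpha_sqr R n).
Proof.
have ubA : ubound (admissible n) (Num.sqrt (alpha_sqr R n)).
  by move=> _ [X [Y [[? ?] ? ? ? ->]]]; exact: set_dist_upper.
apply/eqP; rewrite eq_le; apply/andP; split.
  by apply: ge_sup => //; eexists; exact: orthogonal_simplices.
by apply: ub_le_sup; [eexists; exact: ubA|exact: orthogonal_simplices].
Qed.

Lemma inv_add1_sqrt_div (u v : R) : 0 <= u -> 0 < v ->
  1 / (1 + Num.sqrt (u / v)) = Num.sqrt v / (Num.sqrt v + Num.sqrt u).
Proof.
move=> u0 v0; rewrite sqrtrM// sqrtrV ?ltW//.
have v0' : 0 < Num.sqrt v by rewrite sqrtr_gt0.
have : 0 <= Num.sqrt u by exact: sqrtr_ge0.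
move: (Num.sqrt v) (Num.sqrt u) v0' => a b a0 b0.
by field; rewrite !gt_eqF// ltr_wpDr.
Qed.

Lemma inv_add1_alpha (n : nat) : 1 / (1 + alpha R n) =
    if odd n then
      Num.sqrt ((n%:R + 1) * (n%:R + 3)) /
        (Num.sqrt ((n%:R + 1) * (n%:R + 3)) +
         Num.sqrt (n%:R ^+ 2 + 2 * n%:R - 1))
    else
      Num.sqrt (n%:R + 2) / (Num.sqrt (n%:R + 2) + Num.sqrt n%:R).
Proof.
rewrite alphaE /alpha_sqr.
have h0 : 0 <= n./2%:R :> R by [].
have [on|en] := boolP (odd n).
  have nE : n%:R = 2 * n./2%:R + 1 :> R.
    by rewrite -{1}(odd_double_half n) on natrD -muln2 natrM mulrC addrC.
  have -> : uphalf n = n./2.+1 by lia.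
  rewrite -inv_add1_sqrt_div; last 2 first.
  - by rewrite nE; nra.
  - by rewrite nE; nra.
  congr (1 / (1 + Num.sqrt _)); rewrite nE -!natr1; field.
  by apply/andP; split; lra.
have nE : n%:R = 2 * n./2%:R :> R.
  by rewrite -{1}(odd_double_half n) (negPf en) add0n -muln2 natrM mulrC.
have -> : uphalf n = n./2 by lia.
rewrite -inv_add1_sqrt_div//.
congr (1 / (1 + Num.sqrt _)); rewrite nE -!natr1; field.
by apply/andP; split; lra.
Qed.

End AlphaValue.

(** * From the Hausdorff distance to Borsuk-Ulam *)

Section Normalisation.
Context {R : realType} {p : nat}.
Implicit Types x y : 'rV[R]_p.

Definition unit_vec x : 'rV[R]_p := (enorm x)^-1 *: x.

Lemma unit_vecN x : unit_vec (- x) = - unit_vec x.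
Proof. by rewrite /unit_vec enormN scalerN. Qed.

Lemma enorm_unit_vec x : enorm x != 0 -> enorm (unit_vec x) = 1.
Proof.
by move=> x0; rewrite enormZ ger0_norm ?invr_ge0 ?enorm_ge0// mulVf.
Qed.

Lemma enorm_unit_vec_le1 x : enorm (unit_vec x) <= 1.
Proof.
have [x0|/enorm_unit_vec->//] := eqVneq (enorm x) 0.
by rewrite /unit_vec x0 invr0 scale0r enorm0.
Qed.

Lemma unit_vec_lipschitz (q : R) x y : 1 <= q * enorm x -> 1 <= q * enorm y ->
  enorm (unit_vec x - unit_vec y) <= 2 * q * enorm (x - y).
Proof.
have pos (z : 'rV[R]_p) : 1 <= q * enorm z -> enorm z != 0.
  by apply: contraTneq => ->; rewrite mulr0 -ltNge ltr01.
move=> qx qy; have x0 := pos _ qx; have y0 := pos _ qy.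
have -> : unit_vec x - unit_vec y =
    (enorm x)^-1 *: ((x - y) + (enorm y - enorm x) *: unit_vec y).
  rewrite /unit_vec [in RHS]scalerA mulrBl divff// scalerBl scale1r addrA subrK.
  by rewrite scalerBr scalerA mulrA mulVf// mul1r.
rewrite enormZ ger0_norm ?invr_ge0 ?enorm_ge0// mulrC -ler_pdivlMr; last first.
  by rewrite invr_gt0 lt_neqAle eq_sym x0 enorm_ge0.
rewrite invrK (le_trans (ler_enormD _ _))// enormZ enorm_unit_vec// mulr1.
have := ler_dist_enorm y x; rewrite -(enormN (y - x)) opprB => yx.
have : 1 * enorm (x - y) <= q * enorm x * enorm (x - y).
  by rewrite ler_wpM2r// enorm_ge0.
have -> : q * enorm x * enorm (x - y) = q * enorm (x - y) * enorm x by ring.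
lra.
Qed.

End Normalisation.

Section BallDistortion.
Context {R : realType} (n k : nat).
Local Notation Bm := (closed_unit_ball R (n.+2 + k)).
Local Notation Bn := (closed_unit_ball R n.+1).

Lemma sphere_point_subproof (x : 'rV[R]_n.+2) :
  \sum_i (row_mx (unit_vec x) (0 : 'rV[R]_k)) ord0 i ^+ 2 <= 1.
Proof.
rewrite -sqr_enorm sqr_enorm_row_mx enorm0 expr0n addr0.
by rewrite exprn_ile1 ?enorm_ge0// enorm_unit_vec_le1.
Qed.

Definition sphere_point (x : 'rV[R]_n.+2) : Bm :=
  exist (fun v : 'rV[R]_(n.+2 + k) => is_true (\sum_i v ord0 i ^+ 2 <= 1)) _
    (sphere_point_subproof x).

Lemma mdist_sphere_point x y :
  mdist (sphere_point x) (sphere_point y) = enorm (unit_vec x - unit_vec y).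
Proof.
rewrite closed_unit_ball_mdistE /= opp_row_mx add_row_mx subrr.
apply/eqP; rewrite -(@eqrXn2 _ 2)// ?enorm_ge0// sqr_enorm_row_mx.
by rewrite enorm0 expr0n addr0.
Qed.

(** Restrict [f] to a sphere of dimension [n.+1] and apply Borsuk-Ulam. The
    image [Y] of the antipode of a small simplex is translated by [a - b], to
    make its hull meet that of the image [X] of the simplex: this keeps its
    diameter and changes its distances to [X] by at most [e]. Two close points
    of [X] and [Y] then come from nearly antipodal points. *)
Lemma ball_distortion_ge (f : Bm -> Bn) (r : R) :
    (forall x y, mdist (f x) (f y) <= mdist x y + 2 * r) ->
    (forall x y, mdist x y <= mdist (f x) (f y) + 2 * r) ->
  1 <= r * (1 + alpha R n.+1).
Proof.
move=> fup flow; rewrite alphaE; set A := Num.sqrt _.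
have A0 : 0 <= A by exact: sqrtr_ge0.
rewrite leNgt; apply/negP => rA.
(* The estimates below give 2 <= 2 r (1 + A) + (2 + A) e for every e > 0. *)
pose e := (1 - r * (1 + A)) / (2 + A).
have e0 : 0 < e by rewrite divr_gt0 ?subr_gt0//; lra.
have eE : (2 + A) * e = 1 - r * (1 + A) by rewrite /e; field; lra.
pose q : R := n.+2%:R.
have q0 : 0 < q by rewrite ltr0n.
pose g x := val (f (sphere_point x)).
have gE x y :
    enorm (g x - g y) = mdist (f (sphere_point x)) (f (sphere_point y)).
  by rewrite closed_unit_ball_mdistE.
have g1 x : enorm (g x) <= 1.
  by rewrite enorm_le_sqr// expr1n sqr_enorm; exact: valP (f _).
have e'0 : 0 < e / (2 * q) by rewrite divr_gt0// mulr_gt0.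
have [s [a [b [sq se sab ab]]]] := approximate_borsuk_ulam g1 e'0 e0.
have unit_e x y : x \in s -> y \in s -> enorm (unit_vec x - unit_vec y) <= e.
  move=> xs ys; rewrite (le_trans (unit_vec_lipschitz (sq _ xs) (sq _ ys)))//.
  rewrite -/q mulrC -ler_pdivlMr ?mulr_gt0//; exact: se.
have g_e x y : x \in s -> y \in s ->
    enorm (g x - g y) <= e + 2 * r /\ enorm (g (- x) - g (- y)) <= e + 2 * r.
  move=> xs ys; have := unit_e _ _ xs ys.
  have := fup (sphere_point x) (sphere_point y).
  have := fup (sphere_point (- x)) (sphere_point (- y)).
  rewrite -!gE !mdist_sphere_point !unit_vecN -opprD enormN.
  by lra.
pose X := map g s; pose Y := map (fun x => g (- x) + (a - b)) s.
have Xa : conv_hull [set` X]%classic a.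
  move=> C /convex_setP cC XC.
  apply: (sab [set p : 'rV_n.+1 * 'rV_n.+1 | C p.1]%classic) => [|x xs].
    by apply/convex_setP => x y t t0 t1; exact: cC.
  by apply: XC; rewrite /= map_f.
have Ya : conv_hull [set` Y]%classic a.
  move=> C /convex_setP cC YC.
  have -> : a = b + (a - b) by rewrite addrC subrK.
  pose shifted :=
    [set p : 'rV[R]_n.+1 * 'rV[R]_n.+1 | C (p.2 + (a - b))]%classic.
  suff : shifted (a, b) by [].
  apply: sab => [|x xs].
    apply/convex_setP => x y t t0 t1 /= Cx Cy.
    have := cC _ _ t t0 t1 Cx Cy.
    rewrite (scalerDr t x.2) (scalerDr (1 - t) y.2) addrACA -scalerDl.
    by rewrite [t + _]addrC subrK scale1r.
  by apply: YC; apply/mapP; exists x.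
have := hulls_meet_close (D := e + 2 * r) Xa Ya.
case=> [|_ _ /mapP[x xs ->] /mapP[y ys ->]|].
- by move=> _ _ /mapP[x xs ->] /mapP[y ys ->]; have [] := g_e _ _ xs ys.
- by rewrite opprD addrACA subrr addr0; have [] := g_e _ _ xs ys.
move=> _ [_ [/mapP[x xs ->] /mapP[y ys ->]]]; rewrite -/A => xy.
have gxy : enorm (g x - g (- y)) <= A * (e + 2 * r) + e.
  have -> : g x - g (- y) = (g x - (g (- y) + (a - b))) + (a - b).
    by rewrite opprD (addrA (g x)) subrK.
  by rewrite (le_trans (ler_enormD _ _))// lerD.
have uxy : 2 - e <= enorm (unit_vec x - unit_vec (- y)).
  rewrite unit_vecN opprK.
  have : enorm (2 *: unit_vec x) = 2.
    rewrite enormZ enorm_unit_vec ?mulr1 ?normr_nat//.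
    by apply: contraTneq (sq _ xs) => ->; rewrite mulr0 -ltNge.
  have -> : 2 *: unit_vec x =
      (unit_vec x + unit_vec y) + (unit_vec x - unit_vec y).
    by rewrite addrACA subrr addr0 -mulr2n scaler_nat.
  have := ler_enormD (unit_vec x + unit_vec y) (unit_vec x - unit_vec y).
  by have := unit_e _ _ xs ys; lra.
have := flow (sphere_point x) (sphere_point (- y)).
rewrite -gE mdist_sphere_point => fl.
by nra.
Qed.

End BallDistortion.

(** Every [phi x] is within [r] of some [psi y]; choosing such a [y] for each
    [x] moves both ends of every distance by less than [r]. *)
Lemma distortion_of_hausdorff (R : realType) (X Y Z : metricType R)
    (phi : X -> Z) (psi : Y -> Z) (c : R) :
    isometric_embedding phi -> isometric_embedding psi ->
    (hausdorff_dist (range phi) (range psi) < c%:E)%E ->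
  exists r (f : X -> Y), [/\ r < c,
    (forall x y, mdist (f x) (f y) <= mdist x y + 2 * r) &
    (forall x y, mdist x y <= mdist (f x) (f y) + 2 * r)].
Proof.
move=> phiI psiI; rewrite /hausdorff_dist gt_max => /andP[+ _].
set S := ereal_sup _ => Sc.
have [r rc Sr] : exists2 r : R, r < c & (S < r%:E)%E.
  case: S Sc => [h|//|]; rewrite ?lte_fin => hc.
  - by exists ((h + c) / 2); rewrite ?lte_fin; lra.
  - by exists (c - 1); rewrite ?ltNyr//; lra.
have near x : exists y, mdist (phi x) (psi y) < r.
  have : (ereal_inf
      [set (mdist (phi x) b)%:E | b in range psi]%classic < r%:E)%E.
    apply: le_lt_trans Sr; apply: ereal_sup_ubound.
    by exists (phi x) => //; exists x.
  by case/ereal_inf_lt => _ [_ [y _ <-] <-]; rewrite lte_fin; exists y.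
have [f fr] := choice near.
exists r, f; split=> // x y.
- rewrite -psiI -(phiI x y).
  have := metric_triangle (psi (f x)) (phi x) (psi (f y)).
  have := metric_triangle (phi x) (phi y) (psi (f y)).
  have := fr x; have := fr y; rewrite [mdist (phi x) (psi (f x))]metric_sym.
  by lra.
- rewrite -psiI -(phiI x y).
  have := metric_triangle (phi x) (psi (f x)) (phi y).
  have := metric_triangle (psi (f x)) (psi (f y)) (phi y).
  have := fr x; have := fr y; rewrite [mdist (phi y) (psi (f y))]metric_sym.
  by lra.
Qed.

Theorem theorem2 (R : realType) (m n : nat) (n_ge1 : (1 <= n)%N)
    (n_lt_m : (n < m)%N) :
  ((1 / (1 + alpha R n))%:E <=
     GH_dist (closed_unit_ball R m) (closed_unit_ball R n))%E /\
  1 / (1 + alpha R n) =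
    if odd n then
      Num.sqrt ((n%:R + 1) * (n%:R + 3)) /
        (Num.sqrt ((n%:R + 1) * (n%:R + 3)) +
         Num.sqrt (n%:R ^+ 2 + 2 * n%:R - 1))
    else
      Num.sqrt (n%:R + 2) / (Num.sqrt (n%:R + 2) + Num.sqrt n%:R).
Proof.
split; last exact: inv_add1_alpha.
case: n n_ge1 n_lt_m => // n _ nm.
have [k ->] : exists k, m = (n.+2 + k)%N by exists (m - n.+2)%N; rewrite subnKC.
apply: le_ereal_inf_tmp => _ [Z [phi [psi [phiI psiI ->]]]].
rewrite leNgt; apply/negP => /(distortion_of_hausdorff phiI psiI).
move=> [r [f [rc fup flow]]]; have := ball_distortion_ge fup flow.
have A0 : 0 < 1 + alpha R n.+1 by rewrite ltr_wpDr// alphaE sqrtr_ge0.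
by rewrite leNgt -ltr_pdivlMr// rc.
Qed.
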